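(* Let $n\ge 1$ and let $f\in\mathbb{C}[t,x,y]$ be homogeneous of degree $n$ and invariant under the action of the cyclic group $C_n$. Then for any matrix $A\in\mathbb{C}^{n\times n}$ such that $f=f_A$, there exists a cyclic weighted shift matrix $B\in\mathbb{C}^{n\times n}$ with $\mathcal{W}(A)=\mathcal{W}(B)$.
   Context: $C_n=\langle\Phi\rangle$ with $\Phi(t,x,y)=\big(t,\ \cos(\tfrac{2\pi}{n})x-\sin(\tfrac{2\pi}{n})y,\ \sin(\tfrac{2\pi}{n})x+\cos(\tfrac{2\pi}{n})y\big)$; $f$ is invariant under $C_n$ if $f(\Phi(t,x,y))=f(t,x,y)$. Cyclic weighted shift matrix: a matrix $B=S(b_1,\dots,b_n)\in\mathbb{C}^{n\times n}$ with entries $B_{i,i+1}=b_i$ for $1\le i\le n-1$, $B_{n,1}=b_n$, and all other entries $0$. For $A\in\mathbb{C}^{n\times n}$, $f_A(t,x,y):=\det\big(tI_n+x\,\Re(A)+y\,\Im(A)\big)$, where $\Re(A)=\frac{A+A^{*}}{2}$, $\Im(A)=\frac{A-A^{*}}{2i}$. The numerical range of $A\in\mathbb{C}^{n\times n}$ is $\mathcal{W}(A)=\{x^{*}Ax\in\mathbb{C} : x\in\mathbb{C}^n,\ x^{*}x=1\}$. *)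

(* Defs.v *)
From HB Require Import structures.
From mathcomp Require Import all_boot all_order all_algebra.
From mathcomp Require Import spectral complex.
From mathcomp Require Import classical_sets reals trigo.
(* The notations of mpoly clash with those of mathcomp-analysis. *)
From mathcomp Require Import -(notations) mpoly.

Set Implicit Arguments.
Unset Strict Implicit.
Unset Printing Implicit Defensive.

Import GRing.Theory Num.Theory.
Local Open Scope ring_scope.
Local Open Scope complex_scope.
Local Open Scope sesquilinear_scope.

Definition var_t (R : realType) : mpoly 3 R[i] := mpolyX R[i] (mnm1 (inord 0)).
Definition var_x (R : realType) : mpoly 3 R[i] := mpolyX R[i] (mnm1 (inord 1)).
Definition var_y (R : realType) : mpoly 3 R[i] := mpolyX R[i] (mnm1 (inord 2)).

Definition rotation (R : realType) (n : nat) : 3.-tuple (mpoly 3 R[i]) :=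
  let c := (cos (2 * pi / n%:R : R))%:C in
  let s := (sin (2 * pi / n%:R : R))%:C in
  [tuple var_t R;
         c *: var_x R - s *: var_y R;
         s *: var_x R + c *: var_y R].

Definition cyclic_invariant (R : realType) (n : nat) (f : mpoly 3 R[i]) : Prop :=
  comp_mpoly (rotation R n) f = f.

(* Since [ordS i] has value [i.+1 %% n], this is [b_i] at [(i, i + 1)] and
   [b_n] in the lower left corner. For [n = 1] the matrix is [(b_1)]. *)
Definition cyclic_shift (R : realType) (n : nat) (b : 'I_n -> R[i]) : 'M[R[i]]_n :=
  \matrix_(i, j) (if j == ordS i then b i else 0).

Definition is_cyclic_weighted_shift (R : realType) (n : nat) (B : 'M[R[i]]_n)
    : Prop :=
  exists b : 'I_n -> R[i], B = cyclic_shift b.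

Definition Re_mx (R : realType) (n : nat) (A : 'M[R[i]]_n) : 'M[R[i]]_n :=
  2^-1 *: (A + A ^t*).

Definition Im_mx (R : realType) (n : nat) (A : 'M[R[i]]_n) : 'M[R[i]]_n :=
  (2 * 'i%C)^-1 *: (A - A ^t*).

Definition detrep (R : realType) (n : nat) (A : 'M[R[i]]_n) : mpoly 3 R[i] :=
  \det ((var_t R)%:M
        + var_x R *: map_mx (@mpolyC 3 R[i]) (Re_mx A)
        + var_y R *: map_mx (@mpolyC 3 R[i]) (Im_mx A)).

Definition numerical_range (R : realType) (n : nat) (A : 'M[R[i]]_n) : set R[i] :=
  [set z | exists2 x : 'cV[R[i]]_n,
     x ^t* *m x = 1%:M & z = (x ^t* *m A *m x) 0 0]%classic.

(* Main.v *)
Require Import Defs.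
From mathcomp Require Import all_boot all_order all_algebra.
From mathcomp Require Import ring lra zify.
From mathcomp Require Import spectral polyorder complex.
From mathcomp Require Import boolp classical_sets reals trigo.
From mathcomp Require Import topology normedtype derive.
From mathcomp Require Import -(notations) mpoly.

(** Why the theorem holds.

    Write [M(t, w) = det (t + w A^* + w^-1 A)].  For [w] on the unit circle its
    roots in [t] are, up to sign, the eigenvalues of a hermitian matrix whose
    extreme eigenvalue gives the support line of the numerical range of [A] in
    the direction [w].  Hence (Kippenhahn, [numerical_range_subset]) the
    numerical range only depends on these determinants, and it is enough to
    find a cyclic shift [B] with the same ones.  The numerical range being
    recovered from its support lines rests on its convexity and closedness;
    here both come from one argument, [separation]: if [z] is not a value of
    the form, take the nearest value by compactness of the sphere
    ([nearest_value]); a value beyond the supporting line there would give,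
    after a small step towards it, a value nearer to [z] ([perturb_toward]).

    Invariance under the rotation of order [n] kills, in the Laurent polynomial
    [M(t, .)], all the powers of [w] except [w^-n], [1] and [w^n]
    ([pencil_rotation]).  So [M(t, w) = w^-n c + w^n c^* + p(t)] with
    [c = det A] and [p] a real monic polynomial of degree [n] having the parity
    of [n]; and [p] shifted by any real number of modulus at most [2 |c|] has
    only real roots, as a characteristic polynomial of a hermitian matrix
    ([rotation_invariant_poly]).  A cyclic shift has the same symmetry, being
    conjugate to its multiples by roots of unity.  If [c = 0], all the support
    lines are at the same distance, the numerical range is a disc, and a shift
    with a single nonzero weight has the same one ([singular_case]).

    If [c <> 0], we solve an inverse spectral problem for periodic Jacobi
    matrices with zero diagonal: find weights with [det B = c] and discriminant
    [p].  Put [beta = |c|].  Since [p], [p + 2 beta] and [p - 2 beta]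
    are real-rooted, the [n - 1] critical points [x] of [p] are real, simple, lie
    in the gaps [|p(x)| >= 2 beta], and satisfy [p(x) p''(x) < 0]
    ([critical_points]); they form a set symmetric about zero.  Let [- g(x)] be
    a Floquet multiplier, that is, [p(x) = - beta (g(x) + 1 / g(x))].  The
    measure giving [x] the weight [1 / (C'(x) g(x))], where [C] is the monic
    multiple of [p'], is then positive and even.  Its orthogonal polynomials
    obey a three-term recurrence without diagonal term, the last one vanishes
    at the critical points, and the last but one is proportional to [g] there
    ([orthop_last], [orthop_penultimate]).  The recurrence coefficients are the
    first [n - 2] weights, and the two others are adjusted by the product of
    the weights and by the proportionality factor ([periodic_jacobi_data]).  At
    each critical point the polynomials are the coordinates of a kernel vector
    of the pencil of [B] ([floquet_solution]), which shows that the discriminant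
    of [B] equals [p] there.  Two monic polynomials of degree [n] and parity [n]
    agreeing at [n - 1] points are equal ([monic_parity_eq]). *)

Set Implicit Arguments.
Unset Strict Implicit.
Unset Printing Implicit Defensive.

Import Order.TTheory GRing.Theory Num.Theory.
Import numFieldNormedType.Exports.
Local Open Scope ring_scope.
Local Open Scope complex_scope.
Local Open Scope sesquilinear_scope.

(** * Orthogonal polynomials of a finite even measure *)

Section OrthogonalPolynomials.
Variables (R : realFieldType) (s : seq R) (wt : R -> R).
Implicit Types f g h : {poly R}.
Hypothesis us : uniq s.
Hypothesis wt_gt0 : {in s, forall x, 0 < wt x}.

Definition dotp (f g : {poly R}) : R := \sum_(x <- s) wt x * f.[x] * g.[x].

(** Pairs of consecutive monic orthogonal polynomials. The polynomial of index
    [- 1] is [0], so that the first step divides by zero harmlessly. For an even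
    measure the recurrence has no diagonal term. *)
Fixpoint orthopair (k : nat) : {poly R} * {poly R} :=
  if k is k'.+1 then
    let: (p, q) := orthopair k' in (q, 'X * q - (dotp q q / dotp p p) *: p)
  else (0, 1).
Definition orthop k := (orthopair k).2.
Definition sqnorm k := dotp (orthop k) (orthop k).

Lemma orthop0 : orthop 0 = 1. Proof. by []. Qed.

Lemma orthop1 : orthop 1 = 'X.
Proof. by rewrite /orthop /= scaler0 subr0 mulr1. Qed.

Lemma orthopSS k :
  orthop k.+2 = 'X * orthop k.+1 - (sqnorm k.+1 / sqnorm k) *: orthop k.
Proof. by rewrite /sqnorm /orthop /=; case: (orthopair k). Qed.

Lemma dotpC f g : dotp f g = dotp g f.
Proof. by apply: eq_bigr => x _; rewrite mulrAC. Qed.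

Lemma dotpDr f g h : dotp f (g + h) = dotp f g + dotp f h.
Proof. by rewrite -big_split; apply: eq_bigr => x _; rewrite hornerD mulrDr. Qed.

Lemma dotpZr c f g : dotp f (c *: g) = c * dotp f g.
Proof. by rewrite mulr_sumr; apply: eq_bigr => x _; rewrite hornerZ mulrCA. Qed.

Lemma dotpXr f g : dotp f ('X * g) = dotp ('X * f) g.
Proof. by apply: eq_bigr => x _; rewrite !hornerM hornerX; ring. Qed.

Lemma dotp_gt0 f : f != 0 -> (size f <= size s)%N -> 0 < dotp f f.
Proof.
move=> f0 sf.
have ge0 x : x \in s -> 0 <= wt x * f.[x] * f.[x].
  by move=> xs; rewrite -mulrA -expr2 mulr_ge0 ?sqr_ge0// ltW ?wt_gt0.
rewrite lt_def; apply/andP; split; last first.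
  by rewrite /dotp big_seq; apply: sumr_ge0.
apply/negP => /eqP; rewrite /dotp big_seq => /eqP.
rewrite psumr_eq0// => /allP z.
suff: (size s < size f)%N by rewrite ltnNge sf.
apply: max_poly_roots => //; apply/allP => x xs.
have := z x xs; rewrite xs /= -mulrA mulf_eq0 gt_eqF ?wt_gt0//=.
by rewrite mulf_eq0 orbb.
Qed.

Hypothesis symm : {in s, forall x, (- x \in s) && (wt (- x) == wt x)}.

Lemma dotp_reflect f g :
  dotp f g = \sum_(x <- s) wt x * f.[- x] * g.[- x].
Proof.
have p : perm_eq s (map -%R s).
  have us' : uniq (map -%R s) by rewrite map_inj_uniq//; exact: oppr_inj.
  apply: uniq_perm => // x; apply/idP/mapP => [xs | [y ys ->]].
    by exists (- x); rewrite ?opprK//; case/andP: (symm xs).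
  by case/andP: (symm ys).
rewrite /dotp (perm_big _ p) big_map big_seq [RHS]big_seq.
by apply: eq_bigr => x xs; case/andP: (symm xs) => _ /eqP ->.
Qed.

Definition orthospec k :=
  [/\ orthop k \is monic, size (orthop k) = k.+1,
      forall x, (orthop k).[- x] = (-1) ^+ k * (orthop k).[x] &
      forall g, (size g <= k)%N -> dotp (orthop k) g = 0].

Lemma monic_reduce (p g : {poly R}) k : p \is monic -> size p = k.+1 ->
  (size g <= k.+1)%N -> exists c g', g = c *: p + g' /\ (size g' <= k)%N.
Proof.
move=> mp sp sg; exists g`_k, (g - g`_k *: p); split; first by ring.
apply/leq_sizeP => j kj; rewrite coefB coefZ.
move: kj; rewrite leq_eqVlt => /orP[/eqP <-|kj].
  have -> : p`_k = 1 by move/monicP: mp; rewrite lead_coefE sp.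
  by rewrite mulr1 subrr.
by rewrite [g`_j]nth_default ?[p`_j]nth_default ?mulr0 ?subr0 ?sp// (leq_trans sg).
Qed.

(** [X P_(k+1)] is already orthogonal to the polynomials of degree less than [k],
    because multiplication by [X] is symmetric, and to [P_(k+1)], by parity; only
    its component along [P_k] has to be removed. Positivity of the square norms
    needs the degree to stay below the number of nodes. *)
Lemma orthospecP k : (k < size s)%N -> orthospec k /\ orthospec k.+1.
Proof.
elim: k => [|k IH] ks.
  have o0 : orthospec 0.
    split; rewrite ?orthop0 ?monic1 ?size_poly1//.
      by move=> x; rewrite expr0 mul1r !hornerC.
    by move=> g; rewrite leqn0 size_poly_eq0 => /eqP ->;
       rewrite /dotp big1// => x _; rewrite horner0 mulr0.
  split=> //; split; rewrite ?orthop1 ?monicX ?size_polyX//.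
    by move=> x; rewrite expr1 !hornerX mulN1r.
  move=> g sg; rewrite (size1_polyC sg).
  set c := g`_0.
  have : dotp 'X c%:P = - dotp 'X c%:P.
    rewrite {1}dotp_reflect /dotp -sumrN; apply: eq_bigr => x _.
    by rewrite !hornerE; ring.
  by move/eqP; rewrite -addr_eq0 -mulr2n mulrn_eq0 => /eqP.
have [[m0 s0 par0 ort0] [m1 s1 par1 ort1]] := IH (ltnW ks).
split=> //.
have h0 : sqnorm k != 0.
  by rewrite gt_eqF// dotp_gt0 ?monic_neq0// s0 (ltn_trans _ ks).
have sX : size ('X * orthop k.+1) = k.+3.
  by rewrite mulrC size_mulX ?monic_neq0// s1.
have sz : (size (- ((sqnorm k.+1 / sqnorm k) *: orthop k)) <= k.+1)%N.
  by rewrite size_polyN (leq_trans (size_scale_leq _ _))// s0.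
have szl : (size (- ((sqnorm k.+1 / sqnorm k) *: orthop k)) < 
            size ('X * orthop k.+1)%R)%N by rewrite sX ltnS (leq_trans sz).
split; rewrite orthopSS.
- by rewrite monicE lead_coefDl// lead_coefM lead_coefX mul1r -monicE.
- by rewrite size_polyDl.
- move=> x; rewrite !hornerE par1 par0 !exprS; ring.
- move=> g sg.
have [c [g1 [-> sg1]]] := monic_reduce m1 s1 sg.
have [d [g2 [-> sg2]]] := monic_reduce m0 s0 sg1.
have E f : dotp ('X * orthop k.+1 - (sqnorm k.+1 / sqnorm k) *: orthop k) f
    = dotp (orthop k.+1) ('X * f) - (sqnorm k.+1 / sqnorm k) * dotp (orthop k) f.
  rewrite dotpC dotpDr -scaleNr dotpZr dotpXr mulNr.
  by rewrite dotpC [dotp _ (orthop k)]dotpC dotpXr.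
rewrite !dotpDr !dotpZr !E.
have -> : dotp (orthop k.+1) ('X * orthop k.+1) = 0.
  have : dotp (orthop k.+1) ('X * orthop k.+1)
     = - dotp (orthop k.+1) ('X * orthop k.+1).
    rewrite {1}dotp_reflect /dotp -sumrN; apply: eq_bigr => x _.
    rewrite !hornerM !hornerX par1; set e := _ ^+ _; set v := _.[x].
    have ee : e * e = 1 by rewrite -expr2 sqrr_sign.
    by transitivity (e * e * - (wt x * v * (x * v))); [ring | rewrite ee mul1r].
  by move/eqP; rewrite -addr_eq0 -mulr2n mulrn_eq0 => /eqP.
rewrite [dotp (orthop k) (orthop k.+1)]dotpC ort1 ?s0//.
have -> : dotp (orthop k.+1) ('X * orthop k) = sqnorm k.+1.
  have [c' [g' [Eg sg']]] : exists c g', 'X * orthop k = c *: orthop k.+1 + g' /\ (size g' <= k.+1)%N.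
    by apply: monic_reduce => //; rewrite mulrC size_mulX ?monic_neq0// s0.
  have c1 : c' = 1.
    have := congr1 (fun p : {poly R} => p`_k.+1) Eg.
    rewrite coefXM /= coefD coefZ [g'`_ _]nth_default//.
    move/monicP: m0; rewrite lead_coefE s0 /= => ->.
    by move/monicP: m1; rewrite lead_coefE s1 /= => -> ; rewrite mulr1 addr0.
  by rewrite Eg c1 scale1r dotpDr [dotp _ g']ort1// addr0.
rewrite -/(sqnorm k) divfK// subrr.
rewrite [dotp _ g2]ort0// ort1; last first.
  by rewrite (leq_trans (size_polyMleq _ _))// size_polyX.
by rewrite mulr0; ring.
Qed.

Lemma sqnorm_gt0 k : (k < size s)%N -> 0 < sqnorm k.
Proof.
move=> ks; have [[m0 s0 _ _] _] := orthospecP ks.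
by rewrite dotp_gt0 ?monic_neq0 ?s0.
Qed.

(** The product over the other nodes is the Lagrange polynomial of a node, up to
    the derivative of the nodal polynomial. *)
Lemma prod_rem_horner (x y : R) : x \in s -> y \in s ->
  (\prod_(z <- rem x s) ('X - z%:P)).[y] =
  if y == x then (\prod_(z <- s) ('X - z%:P))^`().[x] else 0.
Proof.
move=> xs ys; have [->|nyx] := eqVneq.
  by rewrite [in RHS](big_rem x)//= derivM derivXsubC !hornerE subrr mul0r addr0.
by apply/rootP; rewrite root_prod_XsubC mem_rem_uniq// !inE nyx.
Qed.

Lemma size_prod_rem (x : R) : x \in s ->
  size (\prod_(z <- rem x s) ('X - z%:P)) = size s.
Proof. by move=> xs; rewrite size_prod_XsubC size_rem// prednK//; case: s xs. Qed.

Lemma dotp_rem f (x : R) : x \in s ->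
  dotp f (\prod_(z <- rem x s) ('X - z%:P))
  = wt x * f.[x] * (\prod_(z <- s) ('X - z%:P))^`().[x].
Proof.
move=> xs; rewrite /dotp (bigD1_seq x)//= prod_rem_horner// eqxx [X in _ + X]big1_seq ?addr0//.
by move=> y /andP[nyx ys]; rewrite prod_rem_horner// (negPf nyx) mulr0.
Qed.

Lemma dotp_prod_root x : x \in s -> (\prod_(z <- s) ('X - z%:P))^`().[x] != 0.
Proof.
move=> xs; have := @prod_rem_horner x x xs xs; rewrite eqxx => <-.
by rewrite -rootE root_prod_XsubC mem_rem_uniq// !inE eqxx.
Qed.

(** Pairing with the Lagrange polynomial of a node isolates the value there, and
    that polynomial has lower degree, hence is orthogonal. *)
Lemma orthop_last x : x \in s -> (orthop (size s)).[x] = 0.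
Proof.
move=> xs; have [_] : orthospec (size s).-1 /\ orthospec (size s).-1.+1.
  by apply: orthospecP; case: s xs.
rewrite prednK; last by case: s xs.
case=> _ _ _ /(_ (\prod_(z <- rem x s) ('X - z%:P))).
rewrite size_prod_rem// leqnn => /(_ isT); rewrite dotp_rem//.
move/eqP; rewrite !mulf_eq0 (negPf (dotp_prod_root xs)) orbF.
by rewrite gt_eqF ?wt_gt0//= => /eqP.
Qed.

(** The Lagrange polynomial of a node is monic of the same degree as the
    orthogonal polynomial, so their product is the square norm. Thus the choice of
    the weights prescribes the values of this polynomial up to a constant. *)
Lemma orthop_penultimate x : x \in s ->
  wt x * (orthop (size s).-1).[x] * (\prod_(z <- s) ('X - z%:P))^`().[x]
  = sqnorm (size s).-1.
Proof.
move=> xs; have sp : ((size s).-1 < size s)%N by case: s xs => //=.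
have [[m0 s0 _ ort] _] := orthospecP sp.
rewrite -dotp_rem//.
have [c [g [Eg sg]]] : exists c g, \prod_(z <- rem x s) ('X - z%:P) = c *: orthop (size s).-1 + g /\ (size g <= (size s).-1)%N.
  by apply: monic_reduce => //; rewrite size_prod_rem// prednK//; case: s xs.
have c1 : c = 1.
  have := congr1 (fun p : {poly R} => p`_(size s).-1) Eg.
  rewrite coefD coefZ [g`_ _]nth_default//.
  have /monicP : \prod_(z <- rem x s) ('X - z%:P) \is monic by apply: monic_prod_XsubC.
  rewrite lead_coefE size_prod_rem// => ->.
  by move/monicP: m0; rewrite lead_coefE s0 /= => ->; rewrite mulr1 addr0.
by rewrite Eg c1 scale1r dotpDr [dotp _ g]ort// addr0.
Qed.

End OrthogonalPolynomials.

(** * Critical points of real-rooted polynomials *)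

Definition splits (F : fieldType) (p : {poly F}) :=
  exists s : seq F, p = \prod_(x <- s) ('X - x%:P).

Lemma deriv_XsubCM (R : comNzRingType) (y : R) (q : {poly R}) :
  (('X - y%:P) * q)^`() = q + ('X - y%:P) * q^`().
Proof. by rewrite derivM derivXsubC mul1r. Qed.

(** Inductive step of Laguerre's inequality
    [p'^2 - p p'' = p^2 * \sum_r (x - r)^-2], written without division. *)
Lemma laguerre_XsubCM (R : comNzRingType) (y x : R) (q : {poly R}) :
  let r := ('X - y%:P) * q in
  r^`().[x] ^+ 2 - r.[x] * r^`()^`().[x]
  = q.[x] ^+ 2 + (x - y) ^+ 2 * (q^`().[x] ^+ 2 - q.[x] * q^`()^`().[x]).
Proof.
rewrite /= deriv_XsubCM derivD deriv_XsubCM.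
by rewrite !(hornerD, hornerM, hornerN, hornerX, hornerC); ring.
Qed.

Lemma laguerre (R : realFieldType) (p : {poly R}) x : splits p ->
  size p != 1 -> p.[x] != 0 -> p.[x] * p^`()^`().[x] < p^`().[x] ^+ 2.
Proof.
case=> s ->; rewrite size_prod_XsubC eqSS size_eq0.
have ge0 (t : seq R) : let q := \prod_(y <- t) ('X - y%:P) in
    0 <= q^`().[x] ^+ 2 - q.[x] * q^`()^`().[x].
  elim: t => [|y t IH] /=.
    by rewrite big_nil derivC deriv0 !hornerE expr2 !mulr0 subrr.
  rewrite big_cons laguerre_XsubCM; apply: addr_ge0; first exact: sqr_ge0.
  by rewrite mulr_ge0 ?sqr_ge0.
case: s => [//|y t] _ p0; rewrite -subr_gt0; move: p0.
rewrite big_cons laguerre_XsubCM hornerM mulf_eq0 negb_or => /andP[_ q0].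
apply: ltr_pwDl; first by rewrite lt_def sqrf_eq0 q0 sqr_ge0.
by apply: mulr_ge0; rewrite ?sqr_ge0//; exact: ge0.
Qed.

Section GaussLucas.
Variable R : rcfType.
Local Notation toC := (map_poly (real_complex R)).

Lemma splits_of_real_roots (q : {poly R}) :
  (forall z : R[i], root (toC q) z -> complex.Im z = 0) ->
  exists s : seq R, q = lead_coef q *: \prod_(x <- s) ('X - x%:P).
Proof.
move=> rr; have [r rE] := closed_field_poly_normal (toC q).
have [->|q0] := eqVneq q 0; first by exists [::]; rewrite lead_coef0 scale0r.
exists (map (@complex.Re R) r); apply: (map_poly_inj (real_complex R)).
rewrite /= [LHS]rE map_polyZ lead_coef_map; congr (_ *: _).
rewrite rmorph_prod big_map big_seq [RHS]big_seq; apply: eq_bigr => z zr.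
rewrite rmorphB /= map_polyX map_polyC /=; congr ('X - _%:P).
rewrite [LHS]complexE rr ?rmorph0 ?mulr0 ?addr0// rE rootZ ?root_prod_XsubC//.
by rewrite lead_coef_eq0 map_poly_eq0.
Qed.

(** Inductive step of the Gauss-Lucas argument: adding the root [y] adds
    [1 / (z - y)] to the logarithmic derivative [v / u], and the imaginary part of
    that term has the sign opposite to that of [z]. *)
Lemma im_log_deriv_step (u v z : R[i]) (y : R) :
  complex.Im z != 0 -> u != 0 -> complex.Im z * complex.Im (v * u^*) <= 0 ->
  complex.Im z * complex.Im ((u + (z - y%:C) * v) * ((z - y%:C) * u)^*) < 0.
Proof.
case: u v z => a b [c d] [e f]; rewrite eq_complex /= => f0 ab.
rewrite !subr0 => h.
have ab0 : 0 < a ^+ 2 + b ^+ 2.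
  by rewrite lt_def addr_ge0 ?sqr_ge0// andbT paddr_eq0 ?sqr_ge0// !sqrf_eq0.
have f2 : 0 < f ^+ 2 by rewrite lt_def sqr_ge0 sqrf_eq0 f0.
have p1 := mulr_gt0 ab0 f2.
have p2 : 0 <= ((e - y) ^+ 2 + f ^+ 2) * - (f * (c * - b + d * a)).
  by rewrite mulr_ge0 ?oppr_ge0// addr_ge0 ?sqr_ge0.
rewrite -oppr_gt0; apply: (lt_le_trans p1); rewrite -subr_ge0.
by apply: (le_trans p2); rewrite le_eqVlt; apply/orP; left; apply/eqP; ring.
Qed.

(** At a non-real point all the terms of [p' / p = \sum_r 1 / (z - r)] have
    imaginary parts of the same sign, so [p'] only vanishes on the real line. *)
Lemma gauss_lucas (p : {poly R}) : splits p -> p != 1 ->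
  exists s : seq R, p^`() = lead_coef p^`() *: \prod_(x <- s) ('X - x%:P).
Proof.
case=> s -> s0; apply: splits_of_real_roots => z rz.
apply/eqP/negPn/negP => Iz0.
have le0 (t : seq R) : let q := toC (\prod_(y <- t) ('X - y%:P)) in
    q.[z] != 0 /\ complex.Im z * complex.Im (q^`().[z] * (q.[z])^*) <= 0 ?= iff (t == [::]).
  elim: t => [|y t [IH0 IH]] /=.
    rewrite big_nil rmorph1 -polyC1 derivC !hornerC mul0r /= mulr0 oner_eq0; split=> //.
    by split; rewrite ?lexx ?eqxx.
  have hz : z - y%:C != 0.
    by apply: contraNneq Iz0 => /(congr1 (@complex.Im R)); case: (z) => a b /=; rewrite subr0 => ->.
  rewrite big_cons rmorphM /= rmorphB /= map_polyX map_polyC /=.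
  move: IH IH0; set q := toC _ => /= IH q0.
  rewrite deriv_XsubCM hornerD !hornerM !hornerXsubC mulf_eq0 negb_or hz q0; split=> //.
  have lt : complex.Im z * complex.Im ((q.[z] + (z - y%:C) * q^`().[z]) * ((z - y%:C) * q.[z])^*) < 0.
    by apply: im_log_deriv_step; rewrite ?IH.
  by apply/leifP.
have [_ h] := le0 s.
move: (h); rewrite deriv_map (rootP rz) mul0r /= mulr0 => -[_ /esym].
by rewrite eqxx => /eqP se; rewrite se big_nil eqxx in s0.
Qed.

End GaussLucas.

Lemma uniq_of_simple_roots (R : fieldType) (s : seq R) :
  (forall x, x \in s -> (\prod_(y <- s) ('X - y%:P))^`().[x] != 0) -> uniq s.
Proof.
elim: s => [//|y s IH] h /=; apply/andP; split.
  apply: contraTN (mem_head y s) => ys; apply/negP => /h.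
  rewrite big_cons derivM derivXsubC !hornerE subrr mul0r addr0 -rootE.
  by rewrite root_prod_XsubC ys.
apply: IH => x xs; have := h x; rewrite inE xs orbT => /(_ isT).
rewrite big_cons derivM derivXsubC !hornerE.
have /rootP -> : root (\prod_(y <- s) ('X - y%:P)) x by rewrite root_prod_XsubC.
by rewrite add0r; apply: contraNneq => ->; rewrite mulr0.
Qed.

(** Laguerre's inequality for [p + c] at a critical point [x] of [p] says that
    [(p(x) + c) p''(x) < 0] unless [p(x) + c = 0]. If [|p(x)| < 2 b], the choices
    [c = 2 b] and [c = - 2 b] contradict each other; so [|p(x)| >= 2 b] and one of
    them gives the sign of [p''(x)], hence also the simplicity of [x]. *)
Lemma critical_points (R : rcfType) (p : {poly R}) (n : nat) (b : R) :
  (0 < n)%N -> size p = n.+1 -> 0 < b ->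
  splits p -> splits (p - (2 * b)%:P) -> splits (p + (2 * b)%:P) ->
  exists s : seq R,
    [/\ uniq s, p^`() = n%:R *: \prod_(x <- s) ('X - x%:P) &
        forall x, x \in s -> 2 * b <= `|p.[x]| /\ p.[x] * p^`()^`().[x] < 0].
Proof.
move=> n0 sp b0 spl splm splp.
have p1 : p != 1 by apply/negP => /eqP pE; move: sp n0; rewrite pE size_poly1 => -[<-].
have pm : p \is monic by case: spl => s ->; exact: monic_prod_XsubC.
have [s] := gauss_lucas spl p1.
have -> : lead_coef p^`() = n%:R.
  rewrite lead_coefE size_deriv sp coef_deriv /= prednK//.
  by move/monicP: pm; rewrite lead_coefE sp /= => ->.
move=> dE; exists s.
have sm c : size (p + c%:P) = n.+1.
  by rewrite size_polyDl// sp (leq_ltn_trans (size_polyC_leq1 _)).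
have crit x : x \in s -> 2 * b <= `|p.[x]| /\ p.[x] * p^`()^`().[x] < 0.
  move=> xs; have d0 : p^`().[x] = 0.
    by apply/rootP; rewrite dE rootZ ?root_prod_XsubC// pnatr_eq0 -lt0n.
  have L c : splits (p + c%:P) -> p.[x] + c != 0 -> (p.[x] + c) * p^`()^`().[x] < 0.
    move=> sc c0; have := @laguerre R (p + c%:P) x sc.
    rewrite sm eqSS -lt0n n0 hornerD hornerC c0 => /(_ isT isT).
    by rewrite derivD derivC addr0 d0 expr0n.
  have Lp := L _ splp; have Lm : p.[x] - 2 * b != 0 -> (p.[x] - 2 * b) * p^`()^`().[x] < 0.
    by apply: L; rewrite polyCN.
  move: Lp Lm; set v := p.[x]; set d := p^`()^`().[x] => Lp Lm.
  have [v2|v2] := lerP (2 * b) `|v|; last first.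
    move: v2; rewrite ltr_norml => /andP[h1 h2].
    have := Lp; rewrite gt_eqF; last lra.
    move=> /(_ isT); rewrite pmulr_rlt0; last lra.
    have := Lm; rewrite lt_eqF; last lra.
    by move=> /(_ isT); rewrite nmulr_rlt0; [lra|lra].
  split=> //; have [v0|v0] := lerP 0 v.
    move: v2; rewrite ger0_norm// => v2.
    have := Lp; rewrite gt_eqF; last lra.
    move=> /(_ isT); rewrite pmulr_rlt0; last lra.
    by move=> ?; rewrite pmulr_rlt0//; lra.
  move: v2; rewrite ltr0_norm// => v2.
  have := Lm; rewrite lt_eqF; last lra.
  move=> /(_ isT); rewrite nmulr_rlt0; last lra.
  by move=> ?; rewrite nmulr_rlt0.
split=> //; apply: uniq_of_simple_roots => x xs.
have [_ h] := crit x xs; apply: contraTneq h => d0.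
by rewrite dE derivZ hornerZ d0 !mulr0 ltxx.
Qed.

(** * Inverse spectral problem for periodic Jacobi matrices with zero diagonal *)

Definition has_parity (R : nzRingType) (n : nat) (p : {poly R}) :=
  p \Po (- 'X) = (-1) ^+ n *: p.

Lemma has_parityE (R : comNzRingType) n (p : {poly R}) x :
  has_parity n p -> p.[- x] = (-1) ^+ n * p.[x].
Proof. by move/(congr1 (horner^~ x)); rewrite horner_comp !hornerE. Qed.

Lemma has_parity_deriv (R : comNzRingType) n (p : {poly R}) :
  has_parity n p -> has_parity n.+1 p^`().
Proof.
move/(congr1 (@deriv R)); rewrite deriv_comp derivN derivX mulrN1 derivZ => h.
by rewrite /has_parity exprS mulN1r scaleNr -h opprK.
Qed.

(** For [|v| >= 2], the root of larger modulus of [g + g^-1 = - v], in a form that is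
    visibly odd in [v] and of sign opposite to [v]. *)
Definition joukowsky_inv (R : rcfType) (v : R) : R :=
  - v * ((1 + Num.sqrt (1 - 4 / v ^+ 2)) / 2).

Lemma joukowsky_invN (R : rcfType) (v : R) :
  joukowsky_inv (- v) = - joukowsky_inv v.
Proof. by rewrite /joukowsky_inv sqrrN !mulNr. Qed.

Lemma joukowsky_invK (R : rcfType) (v : R) : 2 <= `|v| ->
  joukowsky_inv v + (joukowsky_inv v)^-1 = - v.
Proof.
move=> v2; have v0 : v != 0 by rewrite -normr_gt0; lra.
have v4 : 0 <= 1 - 4 / v ^+ 2.
  rewrite subr_ge0 ler_pdivrMr ?mul1r ?exprn_even_gt0//.
  rewrite -[v ^+ 2]real_normK ?num_real//; nra.
rewrite /joukowsky_inv; set s := Num.sqrt _.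
have s0 : 0 <= s by apply: sqrtr_ge0.
have s2 : s ^+ 2 = 1 - 4 / v ^+ 2 by rewrite sqr_sqrtr.
have E : v ^+ 2 * s ^+ 2 = v ^+ 2 - 4 by rewrite s2 mulrBr mulr1 mulrCA divff ?mulr1 ?expf_neq0.
have s1 : 1 + s != 0 by rewrite gt_eqF//; lra.
have : v ^+ 2 * (1 - s ^+ 2) = 4 by rewrite mulrBr E; ring.
move=> F; apply: (mulfI (mulf_neq0 v0 s1)).
transitivity (- ((v ^+ 2 * (1 + s) ^+ 2 + v ^+ 2 * (1 - s ^+ 2)) / 2)).
  by rewrite F; field; rewrite s1 v0.
by field.
Qed.

Lemma joukowsky_inv_mul_lt0 (R : rcfType) (v : R) : v != 0 -> joukowsky_inv v * v < 0.
Proof.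
move=> v0; rewrite /joukowsky_inv; set s := Num.sqrt _.
have s0 : 0 <= s by apply: sqrtr_ge0.
have v2 : 0 < v ^+ 2 by rewrite exprn_even_gt0.
nra.
Qed.

(** The positive numbers [a k] are the weights of a periodic Jacobi matrix with
    zero diagonal, and [q k x] its eigenvector at the critical point [x], with
    Floquet multiplier [- g]. The nodes are the critical points, the weights of the
    measure are chosen by [orthop_penultimate] so that the last but one orthogonal
    polynomial is proportional to [g], and the two coefficients [a l], [a l.+1] that
    the recurrence leaves free absorb the proportionality factor and the
    normalisation of the product. *)
Lemma periodic_jacobi_data (R : rcfType) (p : {poly R}) (l : nat) (b : R) :
  size p = l.+3 -> has_parity l p -> 0 < b ->
  splits p -> splits (p - (2 * b)%:P) -> splits (p + (2 * b)%:P) ->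
  exists (s : seq R) (a : nat -> R) (q : nat -> R -> R),
    [/\ uniq s /\ size s = l.+1,
        forall k, (k < l.+2)%N -> 0 < a k,
        \prod_(k < l.+2) a k = b &
        forall x, x \in s ->
        [/\ q 0 x = 1, q l.+1 x = 0, x = a 0 * q 1 x,
            forall k, (k < l)%N ->
              x * q k.+1 x = a k.+1 * q k.+2 x + a k * q k x &
            exists2 g, g != 0 &
              a l * q l x = g * a l.+1 /\ p.[x] = - (b * (g + g^-1))]].
Proof.
move=> sp par b0 spl splm splp.
have [s [us dE crit]] := critical_points (ltn0Sn l.+1) sp b0 spl splm splp.
have n0 : 0 < l.+2%:R :> R by rewrite ltr0n.
have ss : size s = l.+1.
  have : size p^`() = l.+2 by rewrite size_deriv sp.
  by rewrite dE size_scale ?lt0r_neq0// size_prod_XsubC => -[].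
set C := \prod_(x <- s) _ in dE.
pose g x := joukowsky_inv (p.[x] / b).
pose wt x := (C^`().[x] * g x)^-1.
have d2 x : p^`()^`().[x] = l.+2%:R * C^`().[x] by rewrite dE derivZ hornerZ.
have v2 x : x \in s -> 2 <= `|p.[x] / b|.
  move=> /crit[h _]; rewrite normrM normfV [`|b|]gtr0_norm//.
  by rewrite ler_pdivlMr.
have v0 x : x \in s -> p.[x] / b != 0 by move=> /v2; rewrite -normr_gt0; lra.
have wt0 : {in s, forall x, 0 < wt x}.
  move=> x xs; rewrite invr_gt0; have [_] := crit x xs; rewrite d2.
  have := joukowsky_inv_mul_lt0 (v0 x xs); rewrite -/(g x).
  set c := C^`().[x]; set v := p.[x] => h1.
  rewrite mulrCA (pmulr_rlt0 _ n0) => h2.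
  have h1' : g x * v < 0 by move: h1; rewrite mulrA pmulr_llt0// invr_gt0.
  have : 0 < (g x * v) * (v * c) by rewrite nmulr_rgt0.
  have -> : g x * v * (v * c) = v ^+ 2 * (c * g x) by ring.
  by rewrite pmulr_rgt0// exprn_even_gt0//=; apply: contraTneq h1' => ->; rewrite mulr0 ltxx.
have symm : {in s, forall x, (- x \in s) && (wt (- x) == wt x)}.
  move=> x xs; apply/andP; split.
    have rs y : (y \in s) = root p^`() y by rewrite dE rootZ ?lt0r_neq0// root_prod_XsubC.
    by move: xs; rewrite !rs !rootE (has_parityE _ (has_parity_deriv par)) mulf_eq0 signr_eq0.
  rewrite /wt; apply/eqP; congr (_^-1).
  have dN : C^`().[- x] = (-1) ^+ l * C^`().[x].
    apply: (mulfI (lt0r_neq0 n0)); rewrite mulrCA -!d2.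
    rewrite (has_parityE _ (has_parity_deriv (has_parity_deriv par))).
    by rewrite -addn2 exprD sqrrN expr1n mulr1.
  have gN : g (- x) = (-1) ^+ l * g x.
    rewrite /g (has_parityE _ par) -signr_odd; case: odd; rewrite ?mul1r//.
    by rewrite expr1 !mulN1r mulNr joukowsky_invN.
  by rewrite dN gN mulrACA -expr2 sqrr_sign mul1r.
have h0 k : (k < l.+1)%N -> 0 < sqnorm s wt k by rewrite -ss => ?; exact: sqnorm_gt0.
pose P := orthop s wt.
have Pm x : x \in s -> (P l.+1).[x] = 0 by rewrite /P -ss; exact: orthop_last.
have Pl x : x \in s -> (P l).[x] = sqnorm s wt l * g x.
  move=> xs; have := orthop_penultimate us wt0 symm xs.
  rewrite ss /= -/C -/(P l) /wt => <-.
  have : wt x != 0 by rewrite gt_eqF ?wt0.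
  rewrite /wt invr_eq0 mulf_eq0 negb_or => /andP[c0 g0].
  by field; apply/andP; split.
pose sq k := Num.sqrt (sqnorm s wt k).
have sq0 k : (k < l.+1)%N -> 0 < sq k by move=> ?; rewrite sqrtr_gt0 h0.
have sq2 k : (k < l.+1)%N -> sqnorm s wt k = sq k ^+ 2 by move=> ?; rewrite sqr_sqrtr// ltW// h0.
have sqn k : (k < l.+1)%N -> sq k != 0 by move=> ?; rewrite gt_eqF ?sq0.
(* [kap] is the factor in [q l x = kap * g x], and so has to be the ratio of the
   two free weights; [tau] is the product that is left for them *)
pose kap := sq 0 * sq l.
have kap0 : 0 < kap by rewrite mulr_gt0 ?sq0.
pose tau := b * sq 0 / sq l.
have tau0 : 0 < tau by rewrite !mulr_gt0 ?invr_gt0 ?sq0.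
have tk0 : 0 <= tau / kap by exact: ltW (divr_gt0 tau0 kap0).
pose a k := if (k < l)%N then sq k.+1 / sq k else
            if k == l then Num.sqrt (tau / kap) else Num.sqrt (tau * kap).
have al : a l = Num.sqrt (tau / kap) by rewrite /a ltnn eqxx.
have am : a l.+1 = Num.sqrt (tau * kap) by rewrite /a ltnNge leqnSn/= gtn_eqF.
pose q k x := (P k).[x] * sq 0 / sq k.
exists s, a, q; split => //.
- move=> k kl; rewrite /a; case: ltnP => h; first by rewrite divr_gt0 ?sq0// ltnW.
  by case: eqP => _; rewrite sqrtr_gt0; [exact: divr_gt0 | exact: mulr_gt0].
- rewrite !big_ord_recr /=.
  have -> : \prod_(i < l) a i = sq l / sq 0.
    have : forall j, (j <= l)%N -> \prod_(i < j) a i = sq j / sq 0.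
      elim=> [|j IH] jl; first by rewrite big_ord0 divff ?sqn.
      rewrite big_ord_recr/= IH; last exact: ltnW.
      rewrite /a jl; field; rewrite !sqn//; exact: leq_trans jl _.
    exact.
  rewrite al am -mulrA -sqrtrM//.
  have -> : tau / kap * (tau * kap) = tau ^+ 2 by field; rewrite gt_eqF.
  rewrite sqrtr_sqr gtr0_norm// /tau; field; by rewrite !sqn//.
- move=> x xs; split.
  + by rewrite /q /P orthop0 hornerC mul1r divff ?sqn.
  + by rewrite /q Pm// !mul0r.
  + rewrite /q /a; case: (posnP l) => [l0|l0].
      have : (P l.+1).[x] = 0 by rewrite Pm.
      by rewrite l0 /P orthop1 hornerX => ->; rewrite !mul0r mulr0.
    rewrite /= /P orthop1 hornerX; field; rewrite !sqn//.
  + move=> k kl; rewrite {1}/q.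
    have kl1 : (k < l.+1)%N by rewrite ltnW.
    have -> : a k = sq k.+1 / sq k by rewrite /a kl.
    have -> : a k.+1 * q k.+2 x = (P k.+2).[x] * sq 0 / sq k.+1.
      rewrite /a /q; case: (ltnP k.+1 l) => h; first by field; rewrite !sqn//.
      have -> : k.+2 = l.+1 by congr _.+1; apply/eqP; rewrite eqn_leq kl.
      by rewrite Pm// !mul0r mulr0.
    rewrite /P orthopSS -/(P k.+1) -/(P k) !(hornerD, hornerN, hornerM, hornerX, hornerZ) /q !sq2//.
    by field; rewrite !sqn//.
  + have g0 : g x != 0.
      have := joukowsky_inv_mul_lt0 (v0 x xs); rewrite -/(g x).
      by apply: contraTneq => ->; rewrite mul0r ltxx.
    exists (g x) => //; split.
      rewrite /q Pl// sq2//.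
      have -> : sq l ^+ 2 * g x * sq 0 / sq l = kap * g x by rewrite /kap; field; rewrite sqn.
      rewrite al am [RHS]mulrC mulrA; congr (_ * _).
      rewrite -[X in _ * X = _]gtr0_norm// -sqrtr_sqr -sqrtrM//.
      by congr Num.sqrt; field; rewrite gt_eqF.
    by rewrite joukowsky_invK ?v2//; field; rewrite gt_eqF.
Qed.

(** * Determinants invariant under rotation *)

(** Comparison at infinitely many nonzero points; zero is left out because pencils
    are evaluated at inverses. *)
Lemma poly_ext (F : numDomainType) (p q : {poly F}) :
  (forall k : nat, p.[k.+1%:R] = q.[k.+1%:R]) -> p = q.
Proof.
move=> h; apply/eqP; rewrite -subr_eq0; apply/negPn/negP => d0.
pose s := [seq k.+1%:R : F | k <- iota 0 (size (p - q))].
suff: (size s < size (p - q)%R)%N by rewrite size_map size_iota ltnn.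
apply: max_poly_roots => //.
  by apply/allP => _ /mapP[k _ ->]; rewrite rootE hornerD hornerN h subrr.
rewrite map_inj_uniq ?iota_uniq// => i j /eqP.
by rewrite eqr_nat eqSS => /eqP.
Qed.

Definition pencil (F : pzRingType) n (M N : 'M[F]_n) (t u v : F) :=
  \det (t%:M + u *: M + v *: N).

Section Rotation.
Variables (F : numFieldType) (n : nat) (z : F).
Implicit Types M N : 'M[F]_n.
Hypothesis n_gt0 : (0 < n)%N.
Hypothesis z_prim : n.-primitive_root z.

(** The Laurent polynomial [w |-> pencil M N t w^-1 w] multiplied by [w ^+ n]. *)
Definition pencil_poly (M N : 'M[F]_n) (t : F) : {poly F} :=
  \det ((t *: 'X)%:M + map_mx polyC M + 'X^2 *: map_mx polyC N).

Lemma horner_pencil_poly M N t w :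
  (pencil_poly M N t).[w] = pencil M N (t * w) 1 (w ^+ 2).
Proof.
rewrite -/(horner_eval w _) /pencil_poly -det_map_mx /pencil; congr (\det _).
apply/matrixP => i j; rewrite !mxE /= /horner_eval; case: (i == j);
by rewrite ?mulr1n ?mulr0n !(hornerD, hornerM, hornerZ, hornerX, hornerXn, hornerC, horner0) mul1r.
Qed.

Lemma pencilZ M N c t u v :
  pencil M N (c * t) (c * u) (c * v) = c ^+ n * pencil M N t u v.
Proof.
by rewrite /pencil -detZ !scalerDr !scalerA scale_scalar_mx.
Qed.

Lemma horner_pencil_poly_neq0 M N t w : w != 0 ->
  (pencil_poly M N t).[w] = w ^+ n * pencil M N t w^-1 w.
Proof.
by move=> w0; rewrite horner_pencil_poly -pencilZ mulfV// [w * t]mulrC expr2.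
Qed.

Lemma pencilC M N t u v : pencil M N t u v = pencil N M t v u.
Proof. by rewrite /pencil addrAC. Qed.

Lemma size_pencil_poly M N t : (size (pencil_poly M N t) <= n.*2.+1)%N.
Proof.
rewrite (leq_trans (size_sum _ _ _))//; apply/bigmax_leqP => s _.
rewrite mulr_sign.
have -> : forall (b : bool) (p : {poly F}), size (if b then - p else p) = size p.
  by case=> p; rewrite ?size_polyN.
rewrite (leq_trans (size_prod_leq _ _))// leq_subLR.
rewrite (@leq_trans (\sum_(i < n) 3).+1)//; last first.
  by rewrite sum_nat_const !card_ord; lia.
rewrite ltnS leq_sum// => i _; rewrite !mxE.
have s1 : (size (t *: 'X : {poly F}) <= 3)%N.
  by rewrite (leq_trans (size_scale_leq _ _))// size_polyX.
rewrite (leq_trans (size_polyD _ _))// geq_max; apply/andP; split.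
  rewrite (leq_trans (size_polyD _ _))// geq_max; apply/andP; split.
    by case: (_ == _); rewrite ?mulr1n// mulr0n size_poly0.
  by rewrite (leq_trans (size_polyC_leq1 _)).
rewrite mulrC (leq_trans (size_polyMleq _ _))// size_polyXn addn3 /= .
by rewrite !ltnS size_polyC_leq1.
Qed.

Section Invariant.
Variables M N : 'M[F]_n.
Hypothesis inv : forall t u v,
  pencil M N t u v = pencil M N t (z^-1 * u) (z * v).

Let z0 : z != 0.
Proof.
apply/negP => /eqP zE; have := prim_expr_order z_prim.
by rewrite zE expr0n gtn_eqF// => /eqP; rewrite eq_sym oner_eq0.
Qed.

(** The polynomial is unchanged by [w |-> z w], so its coefficient of index [k] is
    fixed by multiplication by [z ^+ k]. *)
Lemma coef_pencil_poly t k : ~~ (n %| k)%N -> (pencil_poly M N t)`_k = 0.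
Proof.
set Q := pencil_poly M N t => nk.
have E : Q = \poly_(i < size Q) (Q`_i * z ^+ i).
  apply: poly_ext => j; set w : F := _%:R.
  have w0 : w != 0 by rewrite pnatr_eq0.
  transitivity Q.[z * w].
    rewrite !horner_pencil_poly_neq0 ?mulf_neq0// exprMn (prim_expr_order z_prim) mul1r.
    by rewrite inv invfM.
  by rewrite horner_coef horner_poly; apply: eq_bigr => i _; rewrite exprMn mulrA.
have [kl|kl] := ltnP k (size Q); last by rewrite nth_default.
move/(congr1 (fun p : {poly F} => p`_k)): E; rewrite coef_poly kl.
move/eqP; rewrite -subr_eq0 -[X in X - _]mulr1 -mulrBr mulf_eq0 => /orP[/eqP//|].
by rewrite subr_eq0 eq_sym -(prim_order_dvd z_prim) (negPf nk).
Qed.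

Lemma pencil_polyE t :
  pencil_poly M N t = (\det M)%:P + (pencil_poly M N t)`_n *: 'X^n
                      + (pencil_poly M N t)`_n.*2 *: 'X^(n.*2).
Proof.
set Q := pencil_poly M N t.
have Q0 : Q`_0 = \det M.
  rewrite -horner_coef0 horner_pencil_poly /pencil mulr0 expr0n scale0r addr0.
  by rewrite scale1r (_ : 0%:M = 0) ?add0r//; apply/matrixP => i j; rewrite !mxE mul0rn.
apply/polyP => k; rewrite !coefD !coefZ !coefXn coefC -Q0.
have [kn|kn] := boolP (n %| k)%N; last first.
  rewrite coef_pencil_poly//.
  have -> : (k == 0)%N = false by apply: contraNF kn => /eqP ->.
  have -> : (k == n)%N = false by apply: contraNF kn => /eqP ->.
  have -> : (k == n.*2)%N = false by apply: contraNF kn => /eqP ->; rewrite -muln2 dvdn_mulr.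
  by rewrite !mulr0 !addr0.
case/dvdnP: kn => -[|[|[|j]]] ->; rewrite ?mul0n ?mul1n ?mul2n ?eqxx.
- by rewrite !ltn_eqF ?double_gt0// !mulr0 !addr0.
- rewrite gtn_eqF// ltn_eqF ?mulr0 ?mulr1 ?addr0 ?add0r//; lia.
- rewrite !gtn_eqF ?double_gt0 ?mulr0 ?mulr1 ?add0r//; lia.
rewrite nth_default; last by rewrite (leq_trans (size_pencil_poly _ _ _))//; lia.
by rewrite !gtn_eqF ?mulr0 ?addr0//; lia.
Qed.

End Invariant.

(** Only the coefficients of index [0], [n] and [2 n] of [pencil_poly] survive. The
    first is [\det M] by evaluation at zero; the last is [\det N] by the same
    evaluation after exchanging [M] and [N], which reverses the polynomial. *)
Lemma pencil_rotation (M N : 'M[F]_n) :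
  (forall t u v, pencil M N t u v = pencil M N t (z^-1 * u) (z * v)) ->
  forall t w, w != 0 ->
  pencil M N t w^-1 w = w ^- n * \det M + w ^+ n * \det N
                        + (pencil M N t 1 1 - \det M - \det N).
Proof.
move=> inv t w w0.
have wn x : x != 0 -> x ^+ n != 0 :> F by move=> ?; rewrite expf_neq0.
set Q := pencil_poly M N t.
have QE x : Q.[x] = \det M + Q`_n * x ^+ n + Q`_n.*2 * x ^+ n.*2.
  by rewrite {1}/Q (pencil_polyE inv) !(hornerD, hornerZ, hornerC, hornerXn).
have detN : Q`_n.*2 = \det N.
  have E : pencil_poly N M t
           = (Q`_(n.*2))%:P + Q`_n *: 'X^n + (\det M) *: 'X^(n.*2).
    apply: poly_ext => k; set x : F := _%:R.
    have x0 : x != 0 by rewrite pnatr_eq0.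
    rewrite horner_pencil_poly_neq0// pencilC.
    have := QE x^-1; rewrite horner_pencil_poly_neq0 ?invr_eq0// invrK => h.
    have -> : pencil M N t x x^-1 = x ^+ n * ((x^-1) ^+ n * pencil M N t x x^-1).
      by rewrite mulrA -exprMn mulfV// expr1n mul1r.
    rewrite h !(hornerD, hornerZ, hornerC, hornerXn) -addnn !exprD !exprVn.
    by field; exact: wn.
  have := congr1 (horner^~ 0) E; rewrite horner_pencil_poly /pencil mulr0 expr0n.
  rewrite scale0r addr0 scale1r (_ : 0%:M = 0) ?add0r; last first.
    by apply/matrixP => i j; rewrite !mxE mul0rn.
  rewrite !(hornerD, hornerZ, hornerC, hornerXn) !expr0n !gtn_eqF ?double_gt0//.
  by rewrite !mulr0 !addr0.
have E x : x != 0 -> pencil M N t x^-1 x = x ^- n * \det M + x ^+ n * \det N + Q`_n.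
  move=> x0; have := QE x; rewrite horner_pencil_poly_neq0// detN -addnn exprD => h.
  by apply: (mulfI (wn _ x0)); rewrite h; field; exact: wn.
rewrite E//; congr (_ + _).
by have := E 1 (oner_neq0 _); rewrite invr1 expr1n invr1 !mul1r => ->; ring.
Qed.

End Rotation.

(** * Hermitian slices of a matrix *)

Lemma hermitian_diag (R : rcfType) n (H : 'M[R[i]]_n) : H ^t* = H ->
  exists (U : 'M[R[i]]_n) (lam : 'I_n -> R),
    U *m U ^t* = 1%:M /\ H = U ^t* *m diag_mx (\row_i (lam i)%:C) *m U.
Proof.
move=> hH; have hs : H \is hermsymmx.
  by apply/is_hermitianmxP; rewrite expr0 scale1r.
have /orthomx_spectralP HE := hermitian_normalmx hs.
have un := spectral_unitarymx H.
have /mxOverP re := hermitian_spectral_diag_real hs.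
exists (spectralmx H), (fun i => complex.Re (spectral_diag H 0 i)); split.
  exact/unitarymxP.
have -> : \row_i (complex.Re (spectral_diag H 0 i))%:C = spectral_diag H.
  by apply/rowP => i; rewrite mxE RRe_real.
by rewrite -(invmx_unitary un).
Qed.

Lemma det_shift_diag (F : comNzRingType) n (U V : 'M[F]_n) (d : 'rV[F]_n) t :
  U *m V = 1%:M -> \det (t%:M + V *m diag_mx d *m U) = \prod_i (t + d 0 i).
Proof.
move=> UV; have VU := mulmx1C UV.
have -> : t%:M + V *m diag_mx d *m U = V *m (t%:M + diag_mx d) *m U.
  by rewrite mulmxDr mulmxDl scalar_mxC -[_ *m V *m U]mulmxA VU mulmx1.
rewrite !det_mulmx mulrAC -det_mulmx VU det1 mul1r.
have -> : t%:M + diag_mx d = diag_mx (\row_i (t + d 0 i)).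
  by apply/matrixP => i j; rewrite !mxE -mulrnDl.
by rewrite det_diag; apply: eq_bigr => i _; rewrite mxE.
Qed.

Lemma hermitian_det (R : rcfType) n (H : 'M[R[i]]_n) : H ^t* = H ->
  exists q : {poly R}, [/\ splits q, size q = n.+1 &
    forall t : R, \det (t%:C%:M + H) = q.[t]%:C].
Proof.
move=> /hermitian_diag[U [lam [UU ->]]].
have E : \prod_i ('X - (- lam i)%:P) = \prod_(x <- [seq - lam i | i <- enum 'I_n]) ('X - x%:P).
  by rewrite big_map big_enum.
exists (\prod_i ('X - (- lam i)%:P)); split.
- by exists [seq - lam i | i <- enum 'I_n].
- by rewrite E size_prod_XsubC size_map size_enum_ord.
move=> t; rewrite det_shift_diag// horner_prod rmorph_prod.
by apply: eq_bigr => i _; rewrite mxE hornerXsubC opprK rmorphD.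
Qed.

Section AdjointPencil.
Variables (R : rcfType) (n : nat).
Local Notation C := R[i].

(** For [w] on the unit circle, the characteristic determinant of the hermitian
    matrix [- (w M^* + w^-1 M)]. *)
Definition apencil (M : 'M[C]_n) (t w : C) := pencil M (M ^t*) t w^-1 w.

Lemma trmxC_linear (a b : C) (M N : 'M[C]_n) :
  (a *: M + b *: N) ^t* = Num.conj a *: M ^t* + Num.conj b *: N ^t*.
Proof. by apply/matrixP => i j; rewrite !mxE rmorphD !rmorphM. Qed.

Lemma conj_unit (w : C) : `|w| = 1 -> Num.conj w = w^-1.
Proof. by move=> w1; rewrite invC_norm w1 expr1n invr1 mul1r. Qed.

Lemma unit_neq0 (w : C) : `|w| = 1 -> w != 0.
Proof. by move=> w1; rewrite -normr_gt0 w1. Qed.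

Lemma hermitian_slice (M : 'M[C]_n) w : `|w| = 1 ->
  (w^-1 *: M + w *: M ^t*) ^t* = w^-1 *: M + w *: M ^t*.
Proof.
move=> w1; rewrite trmxC_linear trmxCK -[X in Num.conj X *: _](conj_unit w1) conjCK conj_unit//.
by rewrite addrC.
Qed.

Lemma apencilE M t w : apencil M t w = \det (t%:M + (w^-1 *: M + w *: M ^t*)).
Proof. by rewrite /apencil /pencil addrA. Qed.

Lemma apencilN M t w : apencil M (- t) w = (-1) ^+ n * apencil M t (- w).
Proof.
rewrite /apencil -pencilZ !mulN1r invrN !opprK.
by rewrite -[in LHS](opprK w) ?opprK.
Qed.

Lemma det_trmxC (M : 'M[C]_n) : \det (M ^t*) = Num.conj (\det M).
Proof. by rewrite det_map_mx det_tr. Qed.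

Lemma add_conj_real (c : C) : c + Num.conj c = (2 * complex.Re c)%:C.
Proof. by rewrite [LHS]addcJ rmorphM rmorph_nat. Qed.

Definition rotation_invariant (M : 'M[C]_n) :=
  exists2 z : C, n.-primitive_root z &
    forall t u v, pencil M (M ^t*) t u v = pencil M (M ^t*) t (z^-1 * u) (z * v).

(** The coefficient of [w ^+ 0] is real because at [w = 1] the matrix is hermitian.
    Its parity comes from [(t, w) |-> (- t, - w)], which multiplies the pencil by
    [(- 1) ^+ n]. On the unit circle the two rotating terms add up to a real
    constant, so that shifting [p] by it gives the characteristic polynomial of a
    hermitian matrix. *)
Lemma rotation_invariant_poly (M : 'M[C]_n) : (0 < n)%N -> rotation_invariant M ->
  exists p : {poly R},
    [/\ size p = n.+1, p \is monic, has_parity n p,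
        forall (t : R) (w : C), w != 0 ->
          apencil M t%:C w = w ^- n * \det M + w ^+ n * Num.conj (\det M) + p.[t]%:C &
        forall w : C, `|w| = 1 ->
          splits (p + (2 * complex.Re (w ^+ n * Num.conj (\det M)))%:P)].
Proof.
move=> n0 [z zp inv].
have herm w : `|w| = 1 -> exists q : {poly R}, [/\ splits q, size q = n.+1 &
     forall t : R, apencil M t%:C w = q.[t]%:C].
  move=> w1; have [q [qs qn qE]] := hermitian_det (hermitian_slice M w1).
  by exists q; split; [exact: qs | exact: qn | move=> t; rewrite apencilE].
have [|q [qs qn qE]] := herm 1; first by rewrite normr1.
have qm : q \is monic by case: qs => s ->; exact: monic_prod_XsubC.
set b := \det M; set c := (2 * complex.Re b)%:P.
have sp : size (q - c) = n.+1.
  by rewrite size_polyDl ?qn// size_polyN (leq_ltn_trans (size_polyC_leq1 _)).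
have pE (t : R) (w : C) : w != 0 ->
    apencil M t%:C w = w ^- n * b + w ^+ n * Num.conj b + (q - c).[t]%:C.
  move=> w0; rewrite [LHS](pencil_rotation n0 zp inv)// det_trmxC -/b.
  congr (_ + _); rewrite hornerD hornerN hornerC rmorphB /= -qE -add_conj_real.
  by rewrite /apencil invr1; ring.
exists (q - c); split => //.
- rewrite monicE lead_coefDl ?size_polyN ?qn//; last first.
    by rewrite (leq_ltn_trans (size_polyC_leq1 _)).
- apply: poly_ext => k; set t : R := k.+1%:R.
  rewrite horner_comp hornerN hornerX hornerZ.
  apply: (@complexI R); rewrite rmorphM rmorphXn rmorphN rmorph1 /=.
  have h1 := pE (- t) 1 (oner_neq0 _).
  have N1 : -1 != 0 :> C by rewrite oppr_eq0 oner_eq0.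
  have h2 := pE t _ N1.
  move: h1; rewrite [(- t)%:C]rmorphN /= apencilN {}h2.
  rewrite expr1n invr1 !mul1r !mulrDr => h1.
  apply: (@addrI _ (b + Num.conj b)); rewrite -h1 -exprVn invrN1 !mulrA.
  by rewrite -expr2 sqrr_sign !mul1r.
- move=> w w1; have [r [rs rn rE]] := herm w w1.
  suff -> : q - c + (2 * complex.Re (w ^+ n * Num.conj b))%:P = r by [].
  apply: poly_ext => k; set t : R := k.+1%:R.
  apply: (@complexI R); rewrite -rE pE ?unit_neq0// (hornerD (q - c)) hornerC.
  rewrite [RHS]addrC rmorphD /= -add_conj_real rmorphM /= conjCK rmorphXn /= (conj_unit w1).
  by rewrite exprVn [w ^- n * _ + _]addrC.
Qed.

End AdjointPencil.

(** * Cyclic weighted shifts and their Floquet solutions *)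

Section Shift.
Variable R : realType.
Local Notation C := R[i].

Lemma det_cyclic_shift m (b : 'I_m.+1 -> C) :
  \det (cyclic_shift b) = (-1) ^+ m * \prod_i b i.
Proof.
rewrite (expand_det_row _ ord_max) (bigD1 ord0)//= big1 ?addr0; last first.
  move=> j j0; rewrite mxE; case: eqP => [jE|]; last by rewrite mul0r.
  by case/eqP: j0; rewrite jE; apply/val_inj; rewrite /= modnn.
have -> : (cyclic_shift b) ord_max ord0 = b ord_max.
  by rewrite mxE (_ : ordS ord_max = ord0) ?eqxx//; apply/val_inj; rewrite /= modnn.
rewrite /cofactor addn0 big_ord_recr /= mulrCA; congr (_ * _).
rewrite mulrC; congr (_ * _).
have -> : row' ord_max (col' ord0 (cyclic_shift b))
          = diag_mx (\row_j b (widen_ord (leqnSn m) j)).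
  apply/matrixP => i j; rewrite !mxE.
  have -> : lift ord_max i = widen_ord (leqnSn m) i.
    by apply/val_inj; rewrite /= /bump leqNgt ltn_ord add0n.
  have -> : (lift ord0 j == ordS (widen_ord (leqnSn m) i)) = (i == j).
    by rewrite -!val_eqE /= /bump /= add1n modn_small ?ltnS// eqSS eq_sym.
  by case: eqP => [->|]; rewrite ?mulr1n ?mulr0n.
by rewrite det_diag; apply: eq_bigr => i _; rewrite mxE.
Qed.

(** The two matrices are conjugate by the diagonal matrix of the powers of [z]. *)
Lemma cyclic_shift_rotation n (b : 'I_n -> C) (z : C) :
  `|z| = 1 -> n.-primitive_root z -> forall t u v,
  pencil (cyclic_shift b) ((cyclic_shift b) ^t*) t u v
  = pencil (cyclic_shift b) ((cyclic_shift b) ^t*) t (z^-1 * u) (z * v).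
Proof.
move=> z1 zp t u v; rewrite /pencil.
have z0 : z != 0 by rewrite unit_neq0.
pose D := diag_mx (\row_(i < n) z ^+ i).
have dD : \det D != 0.
  by rewrite det_diag prodf_seq_neq0; apply/allP => i _; rewrite mxE expf_neq0.
apply: (mulfI dD); rewrite -det_mulmx [RHS]mulrC -det_mulmx; congr (\det _).
have zS (i : 'I_n) : z ^+ ordS i = z * z ^+ i.
  by rewrite /= (prim_expr_mod zp) exprS.
rewrite mul_diag_mx mul_mx_diag; apply/matrixP => i j; rewrite !mxE.
rewrite !mulrDr !mulrDl; congr (_ + _ + _).
- by case: eqP => [->|]; rewrite ?mulr1n ?mulr0n ?mulr0 ?mul0r// mulrC.
- case: eqP => [->|]; last by rewrite !mulr0 mul0r.
  by rewrite zS; field.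
- case: eqP => [->|]; last by rewrite conjC0 !mulr0 mul0r.
  by rewrite zS; ring.
Qed.

Lemma det0_of_null n (M : 'M[C]_n) (v : 'cV[C]_n) :
  M *m v = 0 -> v != 0 -> \det M = 0.
Proof.
move=> Mv v0; rewrite -det_tr; apply/eqP/det0P; exists v^T.
  by rewrite -(inj_eq (@trmx_inj _ _ _)) trmxK trmx0.
by rewrite -trmx_mul Mv trmx0.
Qed.

(** The vector with coordinates [(- w) ^+ k * q k] is in the kernel: the rows but
    the last one are the recurrence, the last coordinate being zero, and the last
    row is the condition on [w ^+ n]. *)
Lemma floquet_solution l (a : nat -> R) (q : nat -> R) (x : R) (phi w : C) (g : R) :
  w != 0 -> g != 0 ->
  q 0 = 1 -> q l.+1 = 0 -> x = a 0 * q 1 ->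
  (forall k, (k < l)%N -> x * q k.+1 = a k.+1 * q k.+2 + a k * q k) ->
  a l * q l = g * a l.+1 ->
  w ^+ l.+2 = (-1) ^+ l.+1 * phi / g%:C ->
  apencil (cyclic_shift (fun k : 'I_l.+2 =>
     (if k == l.+1 :> nat then phi else 1) * (a k)%:C)) x%:C w = 0.
Proof.
move=> w0 g0 q0 ql x0 xk gE wE.
set b := fun k : 'I__ => _.
pose v := \col_(k < l.+2) ((- w) ^+ k * (q k)%:C).
apply: (@det0_of_null _ _ v); last first.
  apply/eqP => /matrixP /(_ ord0 ord0) /eqP.
  by rewrite !mxE /= expr0 q0 mul1r oner_eq0.
apply/matrixP => i j; rewrite [j]ord1 {j} [RHS]mxE.
rewrite !mulmxDl mul_scalar_mx -!scalemxAl.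
have addE (A B : 'cV[C]_l.+2) : (A + B) i 0 = A i 0 + B i 0 by rewrite mxE.
have scaleE c (A : 'cV[C]_l.+2) : (c *: A) i 0 = c * A i 0 by rewrite mxE.
rewrite !addE !scaleE {addE scaleE}.
have next : (cyclic_shift b *m v) i 0 = b i * v (ordS i) 0.
  rewrite mxE (bigD1 (ordS i))//= mxE eqxx big1 ?addr0// => k /negPf ki.
  by rewrite mxE ki mul0r.
have prev : ((cyclic_shift b)^t* *m v) i 0 = Num.conj (b (ord_pred i)) * v (ord_pred i) 0.
  rewrite mxE (bigD1 (ord_pred i))//= 3!mxE ord_predK eqxx big1 ?addr0// => k ki.
  rewrite 3!mxE; case: eqP => [ik|]; last by rewrite conjC0 mul0r.
  by rewrite ik ordSK eqxx in ki.
rewrite {}next {}prev.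
have vE k : v k 0 = (- w) ^+ k * (q k)%:C by rewrite mxE.
have bE k : b k = (if k == l.+1 :> nat then phi else 1) * (a k)%:C by [].
have aC y : Num.conj y%:C = y%:C :> C by exact: conjc_real.
have gC : g%:C != 0 :> C by apply: contra_neq g0 => /(@complexI R).
rewrite !vE !bE; case: i => [[|k] kl] /=.
  rewrite !modn_small// ql eqxx x0 q0 expr0 expr1.
  by rewrite rmorphM rmorph0 rmorph1 /=; field.
have pk : ((k.+1 + l.+2).-1 %% l.+2)%N = k.
  by rewrite addSn /= modnDr modn_small// ltnW.
rewrite pk; case: (ltngtP k l) => [kl'|kl'|->].
- rewrite modn_small// !ifN ?(ltn_eqF kl') ?ltn_eqF// ?(leqW kl')// !mul1r aC.
  rewrite mulrCA -rmorphM /= (xk _ kl') rmorphD !rmorphM /= !exprS.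
  by field.
- by move: kl; rewrite !ltnS leqNgt kl'.
rewrite modnn eqxx !ifN ?ltn_eqF// mul1r aC ql q0 expr0 rmorph0 rmorph1.
have E : (a l)%:C * (q l)%:C = g%:C * (a l.+1)%:C :> C by rewrite -!rmorphM gE.
apply: (mulfI w0); rewrite mulr0 !mulr0 add0r mulr1.
have -> : w * (w^-1 * (phi * (a l.+1)%:C * 1) + w * ((a l)%:C * ((- w) ^+ l * (q l)%:C)))
  = phi * (a l.+1)%:C + (-1) ^+ l * w ^+ l.+2 * ((a l)%:C * (q l)%:C).
  by rewrite [(- w) ^+ l]exprNn !exprS; field.
rewrite wE E exprS.
have -> : (-1) ^+ l * (-1 * (-1) ^+ l * phi / g%:C) = - phi / g%:C.
  by rewrite !mulrA mulrN1 mulNr -expr2 sqrr_sign mulN1r.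
by field.
Qed.

End Shift.

(** * The cyclic shift with a given determinant *)

(** A polynomial of size [n] has degree [n - 1], which is not of the parity of [n]. *)
Lemma has_parity_lead (R : numDomainType) n (p : {poly R}) :
  has_parity n p -> size p = n -> p = 0.
Proof.
move=> par sp; apply/eqP; rewrite -lead_coef_eq0.
have sX : size (- 'X : {poly R}) = 2 by rewrite size_polyN size_polyX.
have := congr1 lead_coef par; rewrite lead_coef_comp ?sX// lead_coefN lead_coefX.
rewrite lead_coefZ sp; case: n sp {par} => [/eqP|n sp].
  by rewrite size_poly_eq0 => /eqP ->; rewrite lead_coef0.
move/eqP; rewrite /= exprS mulrC mulN1r mulNr -addr_eq0 -mulr2n mulrn_eq0/=.
by rewrite mulf_eq0 signr_eq0.
Qed.

(** The difference loses its two top coefficients, the second one by parity, so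
    [n - 1] common values are enough. *)
Lemma monic_parity_eq (R : numDomainType) n (p q : {poly R}) (s : seq R) :
  p \is monic -> q \is monic -> size p = n.+1 -> size q = n.+1 ->
  has_parity n p -> has_parity n q -> uniq s -> size s = n.-1 ->
  {in s, forall x, p.[x] = q.[x]} -> p = q.
Proof.
move=> pm qm sp sq pp pq us ss h; apply/eqP; rewrite -subr_eq0.
have par : has_parity n (p - q).
  by rewrite /has_parity comp_polyB pp pq scalerBr.
have sn : (size (p - q)%R <= n)%N.
  apply/leq_sizeP => j; rewrite leq_eqVlt coefB => /orP[/eqP <-|nj].
    move: pm qm; rewrite !monicE !lead_coefE sp sq /= => /eqP -> /eqP ->.
    by rewrite subrr.
  by rewrite !nth_default ?subr0 ?sp ?sq.
have [/(has_parity_lead par)->//|sn'] := eqVneq (size (p - q)) n.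
apply/eqP; apply: (@roots_geq_poly_eq0 _ _ s) => //.
  by apply/allP => x xs; rewrite rootE hornerD hornerN h// subrr.
by rewrite ss -ltnS (leq_trans _ (leqSpred _))// ltn_neqAle sn'.
Qed.

Section ShiftOfPoly.
Variable R : realType.
Local Notation C := R[i].

Lemma unit_root n (u : C) : (0 < n)%N -> `|u| = 1 ->
  exists2 w : C, `|w| = 1 & w ^+ n = u.
Proof.
move=> n0 u1; exists (nthroot n u); last by rewrite rootCK.
by rewrite norm_rootC u1 rootC1.
Qed.

Definition cis (t : R) : C := cos t +i* sin t.

Lemma cisX t k : cis t ^+ k = cis (k%:R * t).
Proof.
elim: k => [|k IH]; first by rewrite expr0 mul0r /cis cos0 sin0.
rewrite exprS IH /cis -natr1 mulrDl mul1r addrC cosD sinD.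
by apply/eqP; rewrite eq_complex /= eqxx/= addrC eqxx.
Qed.

(** [1 - cos (2 x) = 2 (sin x)^2] does not vanish when [x] is strictly between
    [0] and [pi]. *)
Lemma cis_prim n : (0 < n)%N -> n.-primitive_root (cis (2 * pi / n%:R)).
Proof.
move=> n0; have nR : 0 < n%:R :> R by rewrite ltr0n.
rewrite /primitive_root_of_unity n0; apply/forallP => i; apply/eqP.
rewrite unity_rootE cisX; case: (eqVneq i.+1 n) => [->|iN].
  have -> : n%:R * (2 * pi / n%:R) = pi *+ 2 :> R by field; rewrite gt_eqF.
  by rewrite /cis cos2pi sin2pi eqxx.
have i1 : (i.+1 < n)%N by rewrite ltn_neqAle iN ltn_ord.
set x : R := i.+1%:R * pi / n%:R.
have x0 : 0 < x by rewrite divr_gt0 ?mulr_gt0 ?pi_gt0 ?ltr0n.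
have xpi : x < pi by rewrite ltr_pdivrMr// mulrC ltr_pM2l ?pi_gt0 ?ltr_nat.
have -> : i.+1%:R * (2 * pi / n%:R) = x *+ 2 :> R by rewrite /x; field; rewrite gt_eqF.
have : 0 < sin x by apply: sin_gt0_pi; rewrite x0 xpi.
rewrite /cis => s0; apply/negbTE; rewrite eq_complex /= negb_and; apply/orP; left.
rewrite cos_mulr2n; have := cos2Dsin2 x => h.
by rewrite lt_eqF//; nra.
Qed.

Lemma norm_cis t : `|cis t| = 1.
Proof. by rewrite normc_def /cis /= cos2Dsin2 sqrtr1. Qed.

(** The solution of the inverse problem. The phase of [c] is put on the last
    weight; the determinant of the shift is then [c], and by [floquet_solution] its
    discriminant takes the same values as [p] at the critical points of [p]. *)
Lemma shift_of_poly l (p : {poly R}) (c : C) :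
  size p = l.+3 -> p \is monic -> has_parity l.+2 p -> c != 0 ->
  (forall w : C, `|w| = 1 ->
     splits (p + (2 * complex.Re (w ^+ l.+2 * Num.conj c))%:P)) ->
  exists b : 'I_l.+2 -> C,
    forall (t : R) (w : C), w != 0 -> apencil (cyclic_shift b) t%:C w
       = w ^- l.+2 * c + w ^+ l.+2 * Num.conj c + p.[t]%:C.
Proof.
move=> sp pm par c0 spl.
have [beta b0 cE] : exists2 be : R, 0 < be & `|c| = be%:C.
  exists (complex.Re `|c|); last by rewrite RRe_real// normr_real.
  by rewrite -ltcR RRe_real ?normr_real// normr_gt0.
(* [w] is chosen so that the rotating term at angle [w] is [2 * Re u * beta];
   [u = 1], [-1] and ['i] then give the three polynomials that have to split *)
have spl' (u : C) : `|u| = 1 -> splits (p + (2 * (complex.Re u * beta))%:P).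
  move=> u1.
  have [|w w1 wE] := @unit_root l.+2 (u * (c / `|c|)) isT.
    by rewrite !normrM normfV normr_id u1 mul1r divff ?normr_eq0.
  have -> : complex.Re u * beta = complex.Re (u * beta%:C).
    by case: (u) => x y /=; rewrite mulr0 subr0.
  suff <- : w ^+ l.+2 * Num.conj c = u * beta%:C by exact: spl.
  rewrite wE -cE -mulrA; congr (_ * _); rewrite mulrAC -normCK.
  by rewrite expr2 mulfK ?normr_eq0.
have splp : splits (p + (2 * beta)%:P).
  by have := spl' 1 (normr1 _); rewrite /= mul1r.
have splm : splits (p - (2 * beta)%:P).
  by have := spl' (-1); rewrite normrN normr1 /= mulN1r mulrN polyCN; apply.
have spl0 : splits p.
  by have := spl' 'i%C; rewrite complexiE normCi /= mul0r mulr0 addr0; apply.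
have parl : has_parity l p by rewrite /has_parity par !exprS !mulN1r opprK.
have [s [a [q [[us ss] a0 aprod qP]]]] :=
  periodic_jacobi_data sp parl b0 spl0 splm splp.
set phi := (-1) ^+ l.+1 * (c / `|c|).
have phi1 : `|phi| = 1.
  by rewrite normrM normrX normrN1 expr1n mul1r normrM normfV normr_id divff ?normr_eq0.
pose b := fun k : 'I_l.+2 => (if k == l.+1 :> nat then phi else 1) * (a k)%:C.
have detb : \det (cyclic_shift b) = c.
  rewrite det_cyclic_shift /b big_split /=.
  have -> : \prod_(i < l.+2) (a i)%:C = `|c| by rewrite -rmorph_prod aprod cE.
  rewrite big_ord_recr /= eqxx big1 ?mul1r; last first.
    by move=> i _; rewrite ifN// ltn_eqF.
  rewrite /phi !mulrA -expr2 sqrr_sign mul1r divfK ?normr_eq0//.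
have binv : rotation_invariant (cyclic_shift b).
  exists (cis (2 * pi / l.+2%:R)); first exact: cis_prim.
  by apply: cyclic_shift_rotation; [exact: norm_cis | exact: cis_prim].
have [r [rsz rm rpar rE _]] := rotation_invariant_poly (ltn0Sn _) binv.
exists b => t w w0; rewrite rE// detb; congr (_ + _%:C); congr (_.[_]).
apply: (@monic_parity_eq _ l.+2 _ _ s) => // x xs.
have [q0 ql x0 xk [g g0 [gE pE]]] := qP x xs.
have gC : g%:C != 0 :> C by apply: contra_neq g0 => /(@complexI R).
(* at this angle the kernel vector of [floquet_solution] closes up *)
have [v0 vE] : exists2 v : C, v != 0 & v ^+ l.+2 = (-1) ^+ l.+1 * phi / g%:C.
  exists (nthroot l.+2 ((-1) ^+ l.+1 * phi / g%:C)); last by rewrite rootCK.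
  rewrite rootC_eq0//; apply: mulf_neq0; last by rewrite invr_eq0.
  by apply: mulf_neq0; [rewrite signr_eq0 | exact: unit_neq0].
move=> vX; have := floquet_solution vE g0 q0 ql x0 xk gE vX.
rewrite -/b rE// detb vX => /eqP; rewrite addrC addr_eq0 => /eqP rx.
apply: (@complexI R); rewrite rx pE.
have -> : (-1) ^+ l.+1 * phi / g%:C = c / `|c| / g%:C.
  by rewrite /phi mulrA -expr2 sqrr_sign mul1r.
rewrite rmorphN rmorphM rmorphD fmorphV /= -cE.
congr (- _); have m0 : `|c| != 0 by rewrite normr_eq0.
move: (normCK c) m0 gC; move: `|c| (g%:C) (Num.conj c) => m h d cd m0 h0.
have -> : c / m / h * d = m / h by rewrite mulrAC [c / m * d]mulrAC -cd; field; rewrite h0.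
by field; rewrite c0 m0 h0.
Qed.
End ShiftOfPoly.

(** * Quadratic forms and small perturbations *)

Section QuadraticForm.
Variables (R : rcfType) (n : nat).
Local Notation C := R[i].
Implicit Types (A H : 'M[C]_n) (x y v : 'cV[C]_n).

Definition sform A x y : C := (x ^t* *m A *m y) 0 0.

Lemma sformDr A x y v : sform A x (y + v) = sform A x y + sform A x v.
Proof. by rewrite /sform mulmxDr mxE. Qed.
Lemma sformDl A x y v : sform A (x + y) v = sform A x v + sform A y v.
Proof.
rewrite /sform; have -> : (x + y) ^t* = x ^t* + y ^t*.
  by apply/matrixP => i j; rewrite !mxE rmorphD.
by rewrite !mulmxDl mxE.
Qed.
Lemma sformZr A c x y : sform A x (c *: y) = c * sform A x y.
Proof. by rewrite /sform -scalemxAr mxE. Qed.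
Lemma sformZl A c x y : sform A (c *: x) y = Num.conj c * sform A x y.
Proof.
rewrite /sform; have -> : (c *: x) ^t* = Num.conj c *: x ^t*.
  by apply/matrixP => i j; rewrite !mxE rmorphM.
by rewrite -!scalemxAl mxE.
Qed.
Lemma sformDm A B x y : sform (A + B) x y = sform A x y + sform B x y.
Proof. by rewrite /sform mulmxDr mulmxDl mxE. Qed.
Lemma sformZm A c x y : sform (c *: A) x y = c * sform A x y.
Proof. by rewrite /sform -scalemxAr -scalemxAl mxE. Qed.
Lemma sform_adj A x y : sform (A ^t*) x y = Num.conj (sform A y x).
Proof.
have -> : Num.conj (sform A y x) = ((y ^t* *m A *m x) ^t*) 0 0.
  by rewrite [RHS]mxE [X in _ = _ X]mxE.
by rewrite trmx_mul map_mxM trmx_mul map_mxM trmxCK mulmxA.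
Qed.
Lemma sform_scalar c x y : sform c%:M x y = c * sform 1%:M x y.
Proof. by rewrite -sformZm scale_scalar_mx mulr1. Qed.

Lemma sform1E x : sform 1%:M x x = \sum_i `|x i 0| ^+ 2.
Proof.
rewrite /sform mulmx1 mxE; apply: eq_bigr => i _.
by rewrite !mxE mulrC normCK.
Qed.

Lemma unit_vecP x : x ^t* *m x = 1%:M <-> sform 1%:M x x = 1.
Proof.
rewrite /sform mulmx1; split => [->|h]; first by rewrite mxE.
by apply/matrixP => i j; rewrite !ord1 h mxE.
Qed.

(** In an eigenbasis the form is an average of the eigenvalues, and the
    determinant vanishes at their opposites. *)
Lemma hermitian_bound H (c : R) : H ^t* = H ->
  (forall t : R, c < t -> \det (t%:C%:M + H) != 0) <->
  (forall x, sform 1%:M x x = 1 -> - c <= complex.Re (sform H x x)).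
Proof.
move=> /hermitian_diag[U [lam [UU HE]]].
have VU := mulmx1C UU.
have detE (t : R) : \det (t%:C%:M + H) = \prod_i (t + lam i)%:C.
  by rewrite HE det_shift_diag//; apply: eq_bigr => i _; rewrite mxE rmorphD.
have formE x : sform H x x = \sum_i (lam i)%:C * `|(U *m x) i 0| ^+ 2.
  have -> : sform H x x = ((U *m x) ^t* *m (diag_mx (\row_i (lam i)%:C) *m (U *m x))) 0 0.
    by rewrite /sform HE trmx_mul map_mxM !mulmxA.
  move: (U *m x) => y; rewrite mul_diag_mx mxE; apply: eq_bigr => i _.
  by rewrite !mxE mulrCA; congr (_ * _); rewrite normCK mulrC.
have normE x : \sum_i `|(U *m x) i 0| ^+ 2 = sform 1%:M x x.
  by rewrite -sform1E /sform !mulmx1 trmx_mul map_mxM !mulmxA -[_ *m U]mulmxA VU mulmx1.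
split=> [h x x1 | h t ct].
  have lam_ge i : - c <= lam i.
    rewrite leNgt; apply/negP => lt; have := h (- lam i).
    rewrite detE (bigD1 i)//= addNr mul0r eqxx => /(_ _)/notF; apply; lra.
  rewrite -lecR RRe_real; last first.
    rewrite formE; apply: rpred_sum => i _.
    by rewrite rpredM ?rpredX ?normr_real// complex_real.
  rewrite formE -[X in X <= _]mulr1 -x1 -normE mulr_sumr; apply: ler_sum => i _.
  by rewrite ler_wpM2r ?exprn_ge0 ?normr_ge0// lecR.
rewrite detE; apply/negP; rewrite prodf_seq_eq0 => /hasP[i _ /= /eqP E].
have {}E : lam i = - t by apply/eqP; rewrite -addr_eq0 addrC; apply/eqP/(@complexI R).
pose x := U ^t* *m delta_mx i 0 : 'cV[C]_n.
have Ux : U *m x = delta_mx i 0 by rewrite mulmxA UU mul1mx.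
have sE (F : 'I_n -> C) : \sum_j F j * `|(U *m x) j 0| ^+ 2 = F i.
  rewrite Ux (bigD1 i)//= mxE !eqxx normr1 expr1n mulr1 big1 ?addr0// => j ji.
  by rewrite mxE (negPf ji) normr0 expr0n mulr0.
have := h x; rewrite -normE formE sE E.
have -> : \sum_j `|(U *m x) j 0| ^+ 2 = 1.
  by rewrite -[RHS](sE (fun=> 1)); apply: eq_bigr => j _; rewrite mul1r.
by move=> /(_ erefl) /=; lra.
Qed.

End QuadraticForm.

(** The squared distance condition behind [perturb_toward]. The terms of first
    order in the step [e] are favourable or zero, and then the favourable term in
    [e ^+ 2 * s] dominates terms of order [e ^+ 4]. *)
Lemma small_step (R : realFieldType) (d k s s2 r : R) :
  0 < d -> 0 <= k -> 0 < s -> exists2 e : R, 0 < e &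
  let P := - (e * k + e ^+ 2 * s) in
  P ^+ 2 + (e ^+ 2 * s2) ^+ 2 + 2 * d * P * (1 + 2 * e * r + e ^+ 2) < 0.
Proof.
move=> d0 k0 s0.
(* [K] bounds the error terms relative to the favourable term, which is linear in
   [d]; the step is such that [e * K = d] *)
set K := k + s + s2 ^+ 2 / s + 4 * d * `|r| + d.
have q0 : 0 <= s2 ^+ 2 / s by rewrite divr_ge0 ?sqr_ge0 ?ltW.
have r0 : 0 <= 4 * d * `|r| by rewrite mulr_ge0 ?normr_ge0// mulr_ge0// ltW.
have dK : d < K by rewrite /K; lra.
have K0 : 0 < K by lra.
set e := d / K; have e0 : 0 < e by rewrite divr_gt0.
have eK : e * K = d by rewrite divfK ?gt_eqF.
have e1 : e < 1 by rewrite ltr_pdivrMr ?mul1r.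
exists e => //=; set Q := e * k + e ^+ 2 * s.
have ek : 0 <= e * k by rewrite mulr_ge0// ltW.
have e2 : 0 < e ^+ 2 by rewrite exprn_gt0.
have es : 0 < e ^+ 2 * s by rewrite mulr_gt0.
have Q0 : 0 < Q by rewrite /Q; lra.
have E : s2 ^+ 2 = s2 ^+ 2 / s * s by rewrite divfK ?gt_eqF.
have h1 : (e ^+ 2 * s2) ^+ 2 <= Q * (e ^+ 2 * (s2 ^+ 2 / s)).
  have -> : (e ^+ 2 * s2) ^+ 2 = (e ^+ 2 * s) * (e ^+ 2 * (s2 ^+ 2 / s)).
    by rewrite exprMn {1}E; ring.
  apply: ler_wpM2r; first by rewrite mulr_ge0 ?sqr_ge0.
  by rewrite /Q; lra.
have ee : e ^+ 2 <= e by rewrite expr2 ler_piMr ?ltW.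
have h2 : Q + e ^+ 2 * (s2 ^+ 2 / s) < 2 * d * (1 + 2 * e * r + e ^+ 2).
  have a1 : e ^+ 2 * s <= e * s by rewrite ler_pM2r.
  have a2 : e ^+ 2 * (s2 ^+ 2 / s) <= e * (s2 ^+ 2 / s) by rewrite ler_wpM2r.
  have a3 : - (4 * d * `|r|) * e <= 4 * d * r * e.
    by rewrite ler_pM2r// -mulrN ler_pM2l ?mulr_gt0// lerNl; have := ler_norm (- r); rewrite normrN; lra.
  have a4 : 0 <= 2 * d * e ^+ 2 by rewrite mulr_ge0 ?sqr_ge0// mulr_ge0// ltW.
  have a5 : e * K = e * k + e * s + e * (s2 ^+ 2 / s) + e * (4 * d * `|r|) + e * d by rewrite /K; ring.
  have a6 : 0 < e * d by rewrite mulr_gt0.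
  rewrite /Q; lra.
have h3 : Q * (Q + e ^+ 2 * (s2 ^+ 2 / s)) < Q * (2 * d * (1 + 2 * e * r + e ^+ 2)).
  by rewrite ltr_pM2l.
rewrite sqrrN; nra.
Qed.

Lemma conjM_conjr (F : numClosedFieldType) (u q : F) :
  Num.conj u * q = Num.conj (u * Num.conj q).
Proof. by rewrite rmorphM /= conjCK. Qed.

(** The imaginary part of [u * p + conj u * q] is that of [u * (p - conj q)], so [u] can be
    chosen to cancel it, and its sign reversed. *)
Lemma align_phase (R : rcfType) (p q : R[i]) :
  exists u : R[i], exists2 k : R, `|u| = 1 & 0 <= k /\
    u * p + Num.conj u * q = - k%:C.
Proof.
have [u0 u1 r0] : exists2 u : R[i], `|u| = 1 & u * p + Num.conj u * q \is Num.real.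
  have [c0|c0] := eqVneq (p - Num.conj q) 0.
    exists 1; first by rewrite normr1.
    rewrite conjC1 !mul1r (eqP _ : p = Num.conj q); last by rewrite -subr_eq0 c0.
    by rewrite addrC add_conj_real complex_real.
  pose c := p - Num.conj q.
  have n0 : `|c| != 0 by rewrite normr_eq0.
  exists (Num.conj c / `|c|); first by rewrite normrM norm_conjC normfV normr_id divff.
  set u := _ / _; have uc : u * c = `|c|.
    by rewrite /u mulrAC [_ * c]mulrC -normCK expr2 mulfK.
  have pE : p = c + Num.conj q by rewrite /c subrK.
  rewrite [in u * p]pE mulrDr uc -addrA.
  rewrite (_ : Num.conj u * q = Num.conj (u * Num.conj q)).
    by rewrite add_conj_real rpredD ?normr_real// complex_real.
  exact: conjM_conjr.
have [k kE] : exists k : R, u0 * p + Num.conj u0 * q = k%:C by apply/complex_realP.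
have [k0|k0] := lerP k 0.
  exists u0, (- k) => //; split; first by rewrite oppr_ge0.
  by rewrite kE rmorphN opprK.
exists (- u0), k; first by rewrite normrN.
by rewrite (ltW k0) rmorphN !mulNr -opprD kE.
Qed.

Section Perturb.
Variables (R : rcfType) (n : nat).
Local Notation C := R[i].
Implicit Types (A : 'M[C]_n) (x y v : 'cV[C]_n).

Lemma sform1_ge0 x : 0 <= sform 1%:M x x.
Proof. by rewrite sform1E sumr_ge0// => i _; rewrite exprn_ge0. Qed.

Lemma sform1C x y : sform 1%:M y x = Num.conj (sform 1%:M x y).
Proof.
rewrite -sform_adj (_ : 1%:M ^t* = 1%:M :> 'M[C]_n)//; apply/matrixP => i j.
by rewrite !mxE eq_sym; case: eqP; rewrite ?mulr1n ?mulr0n ?conjC1 ?conjC0.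
Qed.

Lemma sform_comb A x y c : sform A (x + c *: y) (x + c *: y) =
  sform A x x + (c * sform A x y + Num.conj c * sform A y x)
  + `|c| ^+ 2 * sform A y y.
Proof.
rewrite sformDr !sformDl !sformZr !sformZl normCK.
move: (sform A x x) (sform A x y) (sform A y x) (sform A y y) => xx xy yx yy.
by move: (Num.conj c) => d; ring.
Qed.

(** Local form of the convexity of the numerical range: if [0] is a value and so is
    some number with negative real part, then there is a value nearer to [- d] than
    [0] is. The vector [x] is moved slightly towards [y], with a phase making the
    first-order variation real and non-positive. *)
Lemma perturb_toward A (d : R) x y : 0 < d ->
  sform 1%:M x x = 1 -> sform 1%:M y y = 1 -> sform A x x = 0 ->
  complex.Re (sform A y y) < 0 ->
  exists2 v, sform 1%:M v v = 1 & `|sform A v v + d%:C| < d%:C.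
Proof.
move=> d0 x1 y1 x0 ylt0.
have [u [k u1 [k0 uE]]] := align_phase (sform A x y) (sform A y x).
set s := - complex.Re (sform A y y); set s2 := complex.Im (sform A y y).
set r := complex.Re (u * sform 1%:M x y).
have s0 : 0 < s by rewrite oppr_gt0.
have [e e0 /=] := small_step s2 r d0 k0 s0.
set P := - (_ + _); set N := 1 + _ + _ => ineq.
set v0 := x + (e%:C * u) *: y.
have eu : `|e%:C * u| = e%:C by rewrite normrM u1 mulr1 ger0_norm// lecR ltW.
have eC : Num.conj e%:C = e%:C :> C by exact: conjc_real.
have vN : sform 1%:M v0 v0 = N%:C.
  rewrite sform_comb x1 y1 eu [sform _ y x]sform1C mulr1 rmorphM /= eC.
  have h : u * sform 1%:M x y + Num.conj u * Num.conj (sform 1%:M x y) = (2 * r)%:C.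
    by rewrite -add_conj_real rmorphM.
  have -> : e%:C * u * sform 1%:M x y + e%:C * Num.conj u * Num.conj (sform 1%:M x y)
     = e%:C * (2 * r)%:C by rewrite -h; ring.
  by rewrite /N -[1]/(1%:C) -!(rmorphM, rmorphXn, rmorphD) /=; congr (_%:C); ring.
have vA : sform A v0 v0 = P +i* (e ^+ 2 * s2).
  rewrite sform_comb x0 eu add0r rmorphM /= eC.
  have -> : e%:C * u * sform A x y + e%:C * Num.conj u * sform A y x
     = e%:C * - k%:C by rewrite -uE; ring.
  rewrite [sform A y y]complexE -/s2 -[complex.Re _]opprK -/s /P.
  apply/eqP; rewrite eq_complex /=; apply/andP; split; apply/eqP; ring.
have N0 : 0 < N.
  have := sform1_ge0 v0; rewrite vN ler0c le_eqVlt => /orP[/eqP N0|//].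
  move: ineq; rewrite -N0 mulr0 addr0 ltNge addr_ge0 ?sqr_ge0//.
have NC : N%:C != 0 :> C by rewrite -vN; apply/negP; rewrite vN => /eqP/(@complexI R) h; rewrite h ltxx in N0.
pose c := (Num.sqrt N)^-1%:C : C.
have cc : Num.conj c * c = N%:C^-1.
  have -> : Num.conj c = c by exact: conjc_real.
  by rewrite -rmorphM /= -invfM -expr2 sqr_sqrtr ?ltW// fmorphV.
exists (c *: v0).
  by rewrite sformZl sformZr mulrA cc vN mulVf.
rewrite sformZl sformZr mulrA cc vA.
rewrite -[d%:C](mulKf NC) -mulrDr normrM normfV.
have -> : `|N%:C| = N%:C :> C by rewrite ger0_norm// ler0c ltW.
have Ni : 0 < N%:C^-1 :> C by rewrite invr_gt0 ltcR.
rewrite (ltr_pM2l Ni).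
rewrite -(@ltr_pXn2r _ 2) ?nnegrE ?normr_ge0//; last first.
  by rewrite -rmorphM /= ler0c mulr_ge0// ltW.
rewrite -add_Re2_Im2 -rmorphM -rmorphXn /= ltcR.
by rewrite /= addr0; nra.
Qed.

End Perturb.

(** * The point of the numerical range nearest to a given point *)

Section Compactness.
Local Open Scope classical_set_scope.
Local Open Scope ring_scope.
Local Open Scope complex_scope.
Local Open Scope sesquilinear_scope.
Variables (R : realType) (n : nat).
Local Notation C := R[i].
Local Notation V := 'rV[R]_(n + n).

Definition complex_vec (r : V) : 'cV[C]_n :=
  \col_i (r 0 (lshift n i) +i* r 0 (rshift n i)).

Definition real_vec (x : 'cV[C]_n) : V :=
  row_mx (\row_i complex.Re (x i 0)) (\row_i complex.Im (x i 0)).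

Lemma real_vecK x : complex_vec (real_vec x) = x.
Proof.
apply/matrixP => i j; rewrite ord1 mxE row_mxEl row_mxEr !mxE.
by case: (x i 0).
Qed.

Definition ccontinuous (f : V -> C) :=
  continuous (fun r => complex.Re (f r)) /\ continuous (fun r => complex.Im (f r)).

Lemma ccontinuous_cst c : ccontinuous (fun=> c).
Proof. by split; exact: cst_continuous. Qed.

Lemma ccontinuousD f g : ccontinuous f -> ccontinuous g ->
  ccontinuous (fun r => f r + g r).
Proof.
move=> [f1 f2] [g1 g2]; split.
  rewrite (_ : (fun r => _) = (fun r => complex.Re (f r) + complex.Re (g r))).
    by move=> r; exact: (cvgD (f1 r) (g1 r)).
  by apply/funext => r; case: (f r) (g r) => ? ? [].
rewrite (_ : (fun r => _) = (fun r => complex.Im (f r) + complex.Im (g r))).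
  by move=> r; exact: (cvgD (f2 r) (g2 r)).
by apply/funext => r; case: (f r) (g r) => ? ? [].
Qed.

Lemma ccontinuousM f g : ccontinuous f -> ccontinuous g ->
  ccontinuous (fun r => f r * g r).
Proof.
move=> [f1 f2] [g1 g2]; split.
  rewrite (_ : (fun r => _) = (fun r => complex.Re (f r) * complex.Re (g r) -
     complex.Im (f r) * complex.Im (g r))).
    by move=> r; exact: (cvgB (cvgM (f1 r) (g1 r)) (cvgM (f2 r) (g2 r))).
  by apply/funext => r; case: (f r) (g r) => ? ? [].
rewrite (_ : (fun r => _) = (fun r => complex.Re (f r) * complex.Im (g r) +
     complex.Im (f r) * complex.Re (g r))).
  by move=> r; exact: (cvgD (cvgM (f1 r) (g2 r)) (cvgM (f2 r) (g1 r))).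
by apply/funext => r; case: (f r) (g r) => ? ? [].
Qed.

Lemma ccontinuous_conj f : ccontinuous f -> ccontinuous (fun r => Num.conj (f r)).
Proof.
move=> [f1 f2]; split.
  rewrite (_ : (fun r => _) = (fun r => complex.Re (f r)))//.
  by apply/funext => r; case: (f r).
rewrite (_ : (fun r => _) = (fun r => - complex.Im (f r))).
  by move=> r; exact: (cvgN (f2 r)).
by apply/funext => r; case: (f r).
Qed.

Lemma ccontinuous_sum (I : Type) (s : seq I) (f : I -> V -> C) :
  (forall i, ccontinuous (f i)) -> ccontinuous (fun r => \sum_(i <- s) f i r).
Proof.
move=> h; elim: s => [|i s IH].
  rewrite (_ : (fun r => _) = (fun=> 0)); first exact: ccontinuous_cst.
  by apply/funext => r; rewrite big_nil.
rewrite (_ : (fun r => _) = (fun r => f i r + \sum_(j <- s) f j r)).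
  exact: ccontinuousD.
by apply/funext => r; rewrite big_cons.
Qed.

Lemma ccontinuous_coord i : ccontinuous (fun r => complex_vec r i 0).
Proof.
split.
  rewrite (_ : (fun r => _) = (fun r : V => r 0 (lshift n i))); first exact: coord_continuous.
  by apply/funext => r; rewrite mxE.
rewrite (_ : (fun r => _) = (fun r : V => r 0 (rshift n i))); first exact: coord_continuous.
by apply/funext => r; rewrite mxE.
Qed.

Lemma ccontinuous_sform A : ccontinuous (fun r => sform A (complex_vec r) (complex_vec r)).
Proof.
rewrite (_ : (fun r => _) = (fun r => \sum_j (\sum_i Num.conj (complex_vec r i 0) * A i j) * complex_vec r j 0)).
  apply: ccontinuous_sum => j; apply: ccontinuousM; last exact: ccontinuous_coord.
  apply: ccontinuous_sum => i; apply: ccontinuousM; last exact: ccontinuous_cst.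
  by apply: ccontinuous_conj; exact: ccontinuous_coord.
apply/funext => r; rewrite /sform mxE; apply: eq_bigr => j _; rewrite mxE; congr (_ * _).
by apply: eq_bigr => i _; rewrite !mxE.
Qed.

Definition sphere : set V := [set r | sform 1%:M (complex_vec r) (complex_vec r) = 1].

Lemma sphereE r : sform 1%:M (complex_vec r) (complex_vec r) = (\sum_j r 0 j ^+ 2)%:C.
Proof.
rewrite sform1E big_split_ord /= -big_split rmorph_sum; apply: eq_bigr => i _.
by rewrite mxE -add_Re2_Im2.
Qed.

Lemma compact_sphere : compact sphere.
Proof.
apply: bounded_closed_compact.
  exists 1; split => // m m1 r; rewrite /sphere /= sphereE => /(@complexI R) rE.
  apply: le_trans (ltW m1); rewrite /Num.norm /= mx_normrE.
  apply/bigmax_leP; split => // -[i j] _ /=; rewrite ord1.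
  rewrite -(@ler_pXn2r _ 2) ?nnegrE// real_normK ?num_real// expr1n -rE.
  by rewrite (bigD1 j)//= lerDl sumr_ge0// => k _; rewrite sqr_ge0.
have [c1 _] := ccontinuous_sform 1%:M.
rewrite (_ : sphere = (fun r => complex.Re (sform 1%:M (complex_vec r) (complex_vec r))) @^-1` [set 1]).
  by apply: closed_comp; [move=> r _; exact: c1 | exact: closed_eq].
apply/seteqP; split => r /=; first by move=> ->.
by rewrite /sphere /= sphereE /= => ->.
Qed.

(** A continuous function on a compact sphere, [C^n] being read as [R^2n]. *)
Lemma nearest_value A (z : C) : (0 < n)%N ->
  exists2 x : 'cV[C]_n, sform 1%:M x x = 1 &
    forall y, sform 1%:M y y = 1 -> `|sform A x x - z| <= `|sform A y y - z|.
Proof.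
move=> n0; pose h r := sform A (complex_vec r) (complex_vec r) - z.
pose F r : R := complex.Re (h r) ^+ 2 + complex.Im (h r) ^+ 2.
have [h1 h2] : ccontinuous h.
  by apply: ccontinuousD; [exact: ccontinuous_sform | exact: ccontinuous_cst].
have cF : continuous F.
  by move=> r; exact: (cvgD (cvgM (h1 r) (h1 r)) (cvgM (h2 r) (h2 r))).
have S0 : sphere !=set0.
  exists (real_vec (delta_mx (Ordinal n0) 0)); rewrite /sphere /= real_vecK sform1E.
  rewrite (bigD1 (Ordinal n0))//= mxE !eqxx normr1 expr1n big1 ?addr0// => i i0.
  by rewrite mxE (negPf i0) normr0 expr0n.
have [|r rS rmin] := compact_EVT_min S0 compact_sphere (f := F).
  exact: continuous_subspaceT.
exists (complex_vec r); first by rewrite inE in rS.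
move=> y y1; have : real_vec y \in sphere by rewrite inE /sphere /= real_vecK.
move/rmin; rewrite -lecR /F !add_Re2_Im2 /h real_vecK => le.
by rewrite -(@ler_pXn2r _ 2) ?nnegrE.
Qed.

End Compactness.

(** * Kippenhahn's theorem *)

Section Kippenhahn.
Local Open Scope classical_set_scope.
Local Open Scope ring_scope.
Local Open Scope complex_scope.
Local Open Scope sesquilinear_scope.
Variables (R : realType) (n : nat).
Hypothesis n_gt0 : (0 < n)%N.
Local Notation C := R[i].
Implicit Types (A B : 'M[C]_n).

Lemma numerical_rangeE A z : numerical_range A z <->
  exists2 x, sform 1%:M x x = 1 & z = sform A x x.
Proof. by split=> -[x /unit_vecP x1 zE]; exists x. Qed.

Lemma Re_real_scale (c : C) (d : R) : complex.Re (c + d%:C) = complex.Re c + d.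
Proof. by case: c. Qed.

(** The line is perpendicular to the segment from [z] to the nearest value. *)
Lemma separation A z : ~ numerical_range A z ->
  exists w : C, exists2 d : R, `|w| = 1 &
   (forall x, sform 1%:M x x = 1 -> d <= complex.Re (w^-1 * sform A x x)) /\
   complex.Re (w^-1 * z) < d.
Proof.
move=> zA; have [x0 x01 xmin] := nearest_value A z n_gt0.
set z0 := sform A x0 x0 in xmin; set e := z0 - z in xmin.
have e0 : e != 0.
  apply/negP => /eqP; rewrite /e => /eqP; rewrite subr_eq0 => /eqP h; apply: zA.
  by apply/numerical_rangeE; exists x0.
have [de de0 eE] : exists2 de : R, 0 < de & `|e| = de%:C.
  exists (complex.Re `|e|); last by rewrite RRe_real// normr_real.
  by rewrite -ltcR RRe_real ?normr_real// normr_gt0.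
have ne0 : `|e| != 0 by rewrite normr_eq0.
pose w := e / `|e|; have w1 : `|w| = 1 by rewrite normrM normfV normr_id divff.
have w0 := unit_neq0 w1.
have we : w^-1 * e = de%:C by rewrite -eE /w invfM invrK mulrC mulrA mulfV// mul1r.
exists w, (complex.Re (w^-1 * z0)) => //; split; last first.
  have -> : z0 = z + e by rewrite /e addrC subrK.
  by rewrite mulrDr we Re_real_scale ltrDl.
move=> y y1; rewrite leNgt; apply/negP => lt.
pose A' := w^-1 *: (A + (- z0)%:M).
have A'E x : sform 1%:M x x = 1 -> sform A' x x = w^-1 * (sform A x x - z0).
  by move=> x1; rewrite sformZm sformDm sform_scalar x1 mulr1.
have [| |v v1] := @perturb_toward _ _ A' de x0 y de0 x01 y1.
- by rewrite A'E// subrr mulr0.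
- rewrite A'E// mulrBr; move: lt; case: (w^-1 * _) => a b; case: (w^-1 * _) => c d /=.
  by rewrite -subr_lt0.
rewrite A'E// -we -mulrDr addrA subrK normrM normfV w1 invr1 mul1r we -eE.
by rewrite real_ltNge ?normr_real// xmin.
Qed.

Lemma sform_slice A (w : C) x : `|w| = 1 ->
  sform (w^-1 *: A + w *: A ^t*) x x = (2 * complex.Re (w^-1 * sform A x x))%:C.
Proof.
move=> w1; rewrite sformDm !sformZm sform_adj -add_conj_real; congr (_ + _).
by rewrite rmorphM /= -[in RHS](conj_unit w1) conjCK.
Qed.

Lemma apencil_bound A (w : C) (c : R) : `|w| = 1 ->
  (forall t : R, c < t -> apencil A t%:C w != 0) <->
  (forall x, sform 1%:M x x = 1 -> - c <= 2 * complex.Re (w^-1 * sform A x x)).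
Proof.
move=> w1; have [h1 h2] := hermitian_bound c (hermitian_slice A w1).
split=> [h x x1 | h t ct].
  have /h1/(_ x x1) : forall t : R, c < t ->
      \det (t%:C%:M + (w^-1 *: A + w *: A ^t*)) != 0.
    by move=> t ct; rewrite -apencilE; exact: h.
  by rewrite sform_slice.
by rewrite apencilE; apply: h2 => // x x1; rewrite sform_slice//; exact: h.
Qed.

(** The support lines of the numerical range are read off the extreme roots of the
    characteristic determinants, and by [separation] they determine it. *)
Lemma numerical_range_subset A B :
  (forall (w : C) (c : R), `|w| = 1 ->
     (forall t : R, c < t -> apencil A t%:C w != 0) ->
     (forall t : R, c < t -> apencil B t%:C w != 0)) ->
  numerical_range B `<=` numerical_range A.
Proof.
move=> AB z zB; apply: contrapT => /separation[w [d w1 [dA dz]]].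
have /numerical_rangeE[x x1 zE] := zB.
have hA : forall t : R, - (2 * d) < t -> apencil A t%:C w != 0.
  by apply/apencil_bound => // y y1; rewrite opprK; have := dA y y1; lra.
have /apencil_bound/(_ x x1) := AB w _ w1 hA.
by rewrite opprK -zE => /(_ w1); lra.
Qed.

End Kippenhahn.

(** * From the invariant polynomial to the cyclic shift *)

Section Final.
Local Open Scope classical_set_scope.
Local Open Scope ring_scope.
Local Open Scope complex_scope.
Local Open Scope sesquilinear_scope.
Variable R : realType.
Local Notation C := R[i].

Definition point3 (t x y : C) : 'I_3 -> C := tnth [tuple t; x; y].

Lemma meval_var t x y :
  [/\ meval (point3 t x y) (var_t R) = t, meval (point3 t x y) (var_x R) = x
    & meval (point3 t x y) (var_y R) = y].
Proof.
by rewrite /var_t /var_x /var_y !mevalXU /point3 !(tnth_nth 0) !inordK.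
Qed.

Lemma entry_pencil (S T : pzRingType) n (a b c : T) (g : S -> T) (M N : 'M[S]_n) i j :
  (a%:M + b *: map_mx g M + c *: map_mx g N) i j
  = a *+ (i == j) + b * g (M i j) + c * g (N i j).
Proof. by rewrite !mxE. Qed.

Lemma map_mxE (S T : Type) m n (g : S -> T) (M : 'M[S]_(m, n)) i j :
  (map_mx g M) i j = g (M i j).
Proof. by rewrite mxE. Qed.

Lemma meval_entry v (p q r : mpoly 3 C) (b : bool) (k l : C) :
  meval v (p *+ b + q * mpolyC 3 k + r * mpolyC 3 l)
  = meval v p *+ b + meval v q * k + meval v r * l.
Proof.
rewrite (mevalD v (_ + _)) (mevalD v (_ *+ _)) mevalMn.
rewrite (mevalM v q) (mevalM v r).
by rewrite (mevalC v k) (mevalC v l).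
Qed.

Lemma meval_detrep n (A : 'M[C]_n) t x y :
  meval (point3 t x y) (detrep A) = \det (t%:M + x *: Re_mx A + y *: Im_mx A).
Proof.
have [tE xE yE] := meval_var t x y.
have E (M : 'M[mpoly 3 C]_n) : meval (point3 t x y) (\det M)
    = \det (map_mx (meval (point3 t x y)) M) by rewrite det_map_mx.
rewrite /detrep E; congr (\det _); apply/matrixP => i j.
have entry : ((var_t R)%:M + var_x R *: map_mx (@mpolyC 3 C) (Re_mx A)
    + var_y R *: map_mx (@mpolyC 3 C) (Im_mx A)) i j
  = var_t R *+ (i == j) + var_x R * mpolyC 3 (Re_mx A i j)
    + var_y R * mpolyC 3 (Im_mx A i j).
  exact: entry_pencil.
rewrite map_mxE entry.
rewrite meval_entry tE xE yE.
have := @entry_pencil C C n t x y id (Re_mx A) (Im_mx A) i j.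
by rewrite !map_mx_id.
Qed.

Lemma re_im_comb (F : numFieldType) (j : F) n (M N : 'M[F]_n) u v : j != 0 ->
  u *: M + v *: N
  = (u + v) *: (2^-1 *: (M + N)) + (j * (u - v)) *: ((2 * j)^-1 *: (M - N)).
Proof. by move=> j0; apply/matrixP => a b; rewrite !mxE; field. Qed.

Lemma pencil_Re_Im n (A : 'M[C]_n) t u v :
  pencil A (A ^t*) t u v
  = \det (t%:M + (u + v) *: Re_mx A + ('i%C * (u - v)) *: Im_mx A).
Proof.
rewrite /pencil -addrA (@re_im_comb C 'i%C)//; first by rewrite addrA.
by rewrite complexiE neq0Ci.
Qed.

(** In the coordinates [u = (x - 'i y) / 2] and [v = (x + 'i y) / 2] the pencil is
    [t + u A + v A^*] and the rotation is the multiplication of [u] by [z^-1] and of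
    [v] by [z]. *)
Lemma cyclic_invariant_rotation n (A : 'M[C]_n) : (0 < n)%N ->
  cyclic_invariant n (detrep A) -> rotation_invariant A.
Proof.
move=> n0 inv; set z := cis (2 * pi / n%:R) : C.
exists z; first exact: cis_prim.
have z1 : `|z| = 1 by apply: norm_cis.
have z0 := unit_neq0 z1.
move=> t u v; rewrite !pencil_Re_Im -!meval_detrep -[in LHS]inv comp_mpoly_meval.
apply: meval_eq => i; have [tE xE yE] := meval_var t (u + v) ('i%C * (u - v)).
set P := point3 t (u + v) _ in tE xE yE *.
set c : R := cos (2 * pi / n%:R); set s : R := sin (2 * pi / n%:R).
have zE : z = c%:C + 'i%C * s%:C by rewrite [LHS]complexE.
have zVE : z^-1 = c%:C - 'i%C * s%:C.
  rewrite -(conj_unit z1); apply/eqP; rewrite eq_complex.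
  by apply/andP; split; apply/eqP; rewrite /= -/c -/s; ring.
have ii : 'i%C * 'i%C = -1 :> C by rewrite -expr2 sqr_i.
case: i => [[|[|[|//]]] i3]; rewrite /point3 !(tnth_nth 0) /=.
- by [].
- by rewrite mevalB !mevalZ xE yE zVE zE; ring.
- rewrite mevalD !mevalZ xE yE zVE zE -/s -/c.
  have -> : 'i%C * ((c%:C - 'i%C * s%:C) * u - (c%:C + 'i%C * s%:C) * v)
    = c%:C * ('i%C * (u - v)) - ('i%C * 'i%C) * (s%:C * (u + v)) :> C by ring.
  by rewrite ii; ring.
Qed.

Lemma seq_max (T : realDomainType) (s : seq T) : s != [::] ->
  exists2 m, m \in s & {in s, forall x, x <= m}.
Proof.
elim: s => [//|y [|z s] IH] _.
  by exists y; rewrite ?mem_head// => x; rewrite inE => /eqP ->.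
have [//|m ms mmax] := IH.
have [ym|my] := lerP y m.
  by exists m; [rewrite inE ms orbT | move=> x; rewrite inE => /predU1P[->//|/mmax]].
exists y; first exact: mem_head.
by move=> x; rewrite inE => /predU1P[->//|/mmax/le_trans]; apply; exact: ltW.
Qed.

(** The form of this shift is [rho * x_0^* * x_1], whose values fill the disc of
    radius [rho / 2]. *)
Lemma disc_shift l (rho : R) (w : C) (c : R) : 0 <= rho -> `|w| = 1 ->
  let B := @cyclic_shift R l.+2 (fun i => if i == ord0 then rho%:C else 0) in
  (forall t : R, c < t -> apencil B t%:C w != 0) <-> rho <= c.
Proof.
move=> r0 w1 B; pose i1 : 'I_l.+2 := inord 1.
have i1E : ordS ord0 = i1 :> 'I_l.+2 by apply/val_inj; rewrite /= inordK// modn_small.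
have n01 : i1 != ord0 by rewrite -val_eqE /= inordK.
have formE x : sform B x x = rho%:C * (Num.conj (x ord0 0) * x i1 0).
  rewrite /sform mxE (bigD1 i1)//= big1 ?addr0.
    rewrite mxE (bigD1 ord0)//= !mxE i1E eqxx big1 ?addr0; first by ring.
    by move=> i /negPf i0; rewrite !mxE i0; case: (_ == _); rewrite mulr0.
  move=> j ji; rewrite mxE big1 ?mul0r// => i _; rewrite !mxE.
  case: (eqVneq i ord0) => [->|i0]; last by case: (_ == _); rewrite mulr0.
  by rewrite i1E (negPf ji) mulr0.
rewrite apencil_bound//; move: B formE => B formE.
have wV1 : `|w^-1| = 1 by rewrite normfV w1 invr1.
split=> [h | rc x x1].
  (* the form reaches its minimum [- rho] at [(1, - w) / sqrt 2] *)
  pose k : R := (Num.sqrt 2)^-1.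
  have k2 : k ^+ 2 = 2^-1 by rewrite exprVn sqr_sqrtr.
  pose x : 'cV[C]_l.+2 := \col_i (if i == ord0 then k%:C else if i == i1 then - w * k%:C else 0).
  have x0 : x ord0 0 = k%:C by rewrite mxE eqxx.
  have xi1 : x i1 0 = - w * k%:C by rewrite mxE (negPf n01) eqxx.
  have kk : k%:C * k%:C = 2^-1 :> C by rewrite -rmorphM /= -expr2 k2 fmorphV rmorph_nat.
  have x1 : sform 1%:M x x = 1.
    rewrite sform1E (bigD1 ord0)//= (bigD1 i1)//= big1 ?addr0.
      rewrite x0 xi1 normrM normrN w1 mul1r !normCK.
      rewrite (_ : Num.conj k%:C = k%:C) ?kk; last exact: conjc_real.
      by field.
    by move=> i /andP[/negPf i0 /negPf ii1]; rewrite mxE i0 ii1 normr0 expr0n.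
  have := h x x1; rewrite formE x0 xi1.
  have -> : w^-1 * (rho%:C * (Num.conj k%:C * (- w * k%:C))) = (- (rho * k ^+ 2))%:C.
    rewrite (_ : Num.conj k%:C = k%:C); last exact: conjc_real.
    rewrite rmorphN !rmorphM /=; have w0 := unit_neq0 w1.
    by field.
  by rewrite k2 /=; lra.
set a := x ord0 0; set b := w^-1 * x i1 0.
have ab : complex.Re a ^+ 2 + complex.Im a ^+ 2 + (complex.Re b ^+ 2 + complex.Im b ^+ 2) <= 1.
  rewrite -lecR rmorphD /= !add_Re2_Im2 /b normrM wV1 mul1r.
  move: x1; rewrite sform1E (bigD1 ord0)//= (bigD1 i1)//= addrA => h.
  rewrite -[1%:C]/(1 : C) -h lerDl; apply: sumr_ge0 => i _; exact: exprn_ge0.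
have -> : w^-1 * sform B x x = rho%:C * (Num.conj a * b).
  by rewrite formE -/a /b; ring.
move: a b ab => [a1 a2] [b1 b2] /= ab.
have : 0 <= rho * (1 + 2 * (a1 * b1 + a2 * b2)) 
  by rewrite mulr_ge0//; have := sqr_ge0 (a1 + b1); have := sqr_ge0 (a2 + b2); nra.
rewrite !mul0r !subr0; nra.
Qed.

(** When the determinant vanishes the characteristic determinants do not depend on
    [w]: all the support lines of the numerical range are at the same distance from
    the origin. By parity the largest root is non-negative. *)
Lemma singular_case l (A : 'M[C]_l.+2) : rotation_invariant A -> \det A = 0 ->
  exists B : 'M[C]_l.+2, is_cyclic_weighted_shift B /\ numerical_range A = numerical_range B.
Proof.
move=> inv dA; have [p [sp pm par pE spl]] := rotation_invariant_poly (ltn0Sn _) inv.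
have {}pE t w : `|w| = 1 -> apencil A t%:C w = p.[t]%:C.
  by move=> w1; rewrite pE ?unit_neq0// dA conjC0 !mulr0 !add0r.
have [s ps] : splits p.
  by have := spl 1 (normr1 _); rewrite dA conjC0 mulr0 /= mulr0 addr0.
have [|rho rs rmax] := @seq_max R s.
  by apply/negP => /eqP s0; move: sp; rewrite ps s0 big_nil size_poly1.
have rs' x : (x \in s) = (p.[x] == 0) by rewrite ps -rootE root_prod_XsubC.
have rho0 : 0 <= rho.
  have : - rho \in s by move: rs; rewrite !rs' (has_parityE _ par) mulf_eq0 orbC => ->.
  by move/rmax; rewrite -subr_ge0; lra.
have key (w : C) (c : R) : `|w| = 1 ->
    (forall t : R, c < t -> apencil A t%:C w != 0) <-> rho <= c.
  move=> w1; split => [h | rc t ct].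
    rewrite leNgt; apply/negP => /h; rewrite pE//.
    by move: rs; rewrite rs' => /eqP ->; rewrite eqxx.
  rewrite pE//; apply/eqP => /(@complexI R)/eqP; rewrite -rs' => /rmax.
  by rewrite leNgt (le_lt_trans rc).
have [B Bs keyB] : exists2 B : 'M[C]_l.+2, is_cyclic_weighted_shift B &
    forall (w : C) (c : R), `|w| = 1 ->
      (forall t : R, c < t -> apencil B t%:C w != 0) <-> rho <= c.
  exists (@cyclic_shift R l.+2 (fun i => if i == ord0 then rho%:C else 0)).
    by eexists.
  by move=> w c; exact: disc_shift.
exists B; split; first exact: Bs.
apply/seteqP; split.
  apply: (numerical_range_subset (ltn0Sn _)) => w c w1 h.
  exact/(key w c w1)/(keyB w c w1).
apply: (numerical_range_subset (ltn0Sn _)) => w c w1 h.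
exact/(keyB w c w1)/(key w c w1).
Qed.

Lemma regular_case l (A : 'M[C]_l.+2) : rotation_invariant A -> \det A != 0 ->
  exists B : 'M[C]_l.+2, is_cyclic_weighted_shift B /\ numerical_range A = numerical_range B.
Proof.
move=> inv dA; have [p [sp pm par pE spl]] := rotation_invariant_poly (ltn0Sn _) inv.
have [b bE] := shift_of_poly sp pm par dA spl.
exists (cyclic_shift b); split; first by exists b.
have E (t : R) w : `|w| = 1 -> apencil A t%:C w = apencil (cyclic_shift b) t%:C w.
  by move=> /unit_neq0 w0; rewrite pE// bE.
apply/seteqP; split.
  apply: (numerical_range_subset (ltn0Sn _)) => w c w1 h t ct.
  by rewrite E//; exact: h.
apply: (numerical_range_subset (ltn0Sn _)) => w c w1 h t ct.
by rewrite -E//; exact: h.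
Qed.

End Final.

Theorem corollary1p7 (R : realType) (n : nat) (hn : (1 <= n)%N)
    (f : mpoly 3 R[i])
    (hf : f \is ishomog1 n mdeg)
    (finv : cyclic_invariant n f)
    (A : 'M[R[i]]_n) (hA : f = detrep A) :
  exists B : 'M[R[i]]_n,
    is_cyclic_weighted_shift B /\ numerical_range A = numerical_range B.
Proof.
rewrite {f hf}hA in finv *; have {finv} := cyclic_invariant_rotation hn finv.
case: n hn A => [//|[|l]] _ A inv.
  exists A; split=> //; exists (fun=> A 0 0).
  by apply/matrixP => i j; rewrite mxE !ord1 eqxx.
have [dA|dA] := eqVneq (\det A) 0; first exact: singular_case.
exact: regular_case.
Qed.
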